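(* Let $k$ be an algebraically closed field of characteristic $p>0$ and let $H_R$, $R=(G,\chi,a,\alpha)$, be a pointed rank one Hopf algebra over $k$ of first type which is not of nilpotent type and which has a semi-simple coradical. Let $N$ be the order of $\chi(a)$. Then each block of $H_R$ is Morita equivalent to the Taft algebra $\Gamma_{N,\chi(a)}$ or to the matrix ring $M_N(k)$.
   Context: First type $H_R$. Let $R=(G,\chi,a,\alpha)$ where $G$ is a finite group, $a\in Z(G)$, $\chi:G\to k^*$ a linear character with $\chi(a)\ne 1$, $\alpha=(\alpha_{-1},\alpha_0,\dots,\alpha_{r-1})\in k^{r+1}$, $r\ge 0$. Let $N$ be the order of $\chi(a)$ and $n=p^rN$. It is assumed that $\alpha_{-1}=0$ if $a^n=1$; that if $\alpha_i\ne0$ for some $i\ge0$ then $a^{N(p^r-p^i)}=1$ and $\chi(g)^{N(p^r-p^i)}=1$ for all $g\in G$; and that if $\alpha_{-1}\neq0$ then $\chi(g)^{Np^r}=1$ for all $g\in G$. $H_R$ is the algebra containing $kG$ and an element $x$, with basis $(gx^i)_{g\in G,\,0\le i\le n-1}$ and relations $gxg^{-1}=\chi(g)x$ ($g\in G$), $x^n=\alpha_{-1}(a^n-1)+\sum_{i=0}^{r-1}\alpha_ix^{p^iN}$; its Hopf structure is $\Delta(gx^i)=(g\otimes g)(x\otimes a+1\otimes x)^i$, $\epsilon(gx^i)=\delta_{i,0}$, $S(gx^i)=(-xa^{-1})^ig^{-1}$. It is pointed with coradical $H_0=kG$. A pointed $H$ has rank one if $\dim_k k\otimes_{H_0}H_1=2$,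 where $H_1=\Delta^{-1}(H\otimes H_0+H_0\otimes H)$ and $k$ is trivial via the counit; $H_R$ is of rank one exactly when $r=0$. Nilpotent type: with $P_{a,1}=\{y:\Delta(y)=y\otimes a+1\otimes y\}$, a rank one $H_R$ is of nilpotent type if there is an eigenvector $y\in P_{a,1}\setminus H_0$ of the conjugation action of $a$ with $y^n=0$, where $n$ is the degree of $y$ (the smallest $n$ with $y^n\in\sum_{i<n}H_0y^i$). The Taft algebra $\Gamma_{N,q}$, for $q$ a primitive $N$-th root of unity, is the $N^2$-dimensional $k$-algebra generated by $g,y$ with relations $g^N=1$, $y^N=0$, $gy=q\,yg$. A block of an algebra is an indecomposable two-sided ideal direct summand. *)

(* Defs.v *)
From HB Require Import structures.
From mathcomp Require Import all_boot all_order all_algebra all_fingroup.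
From mathcomp Require Import all_solvable all_field.

Set Implicit Arguments.
Unset Strict Implicit.
Unset Printing Implicit Defensive.

Import GRing.Theory VectorInternalTheory.
Local Open Scope ring_scope.

(* The tensor product of two finite dimensional spaces, in the coordinates
   given by their canonical bases: [tens u v] is the rank one array of the
   products of the coordinates of u and v.  The coordinates are an
   implementation detail; tensor A B is NOT used with matrix multiplication,
   but with the product (a (x) b) (c (x) d) = ac (x) bd installed below. *)
Definition tensor (k : fieldType) (V W : vectType k) : Type :=
  'M[k]_(dim V, dim W).

HB.instance Definition _ (k : fieldType) (V W : vectType k) :=
  Vector.copy (tensor V W) 'M[k]_(dim V, dim W).

Definition tens (k : fieldType) (V W : vectType k) (u : V) (v : W) :
  tensor V W := (v2r u)^T *m v2r v.

Definition tensv (k : fieldType) (V W : vectType k)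
    (U : {vspace V}) (U' : {vspace W}) : {vspace tensor V W} :=
  <<[seq tens u v | u <- vbasis U, v <- vbasis U']>>%VS.

Definition stdvec (k : fieldType) (V : vectType k) (i : 'I_(dim V)) : V :=
  r2v (delta_mx 0 i).

Section TensorSpace.
Variables (k : fieldType) (V W : vectType k).
Implicit Types (u : V) (v : W) (t : tensor V W).

Lemma tensE u v i j : (tens u v : 'M_(_, _)) i j = v2r u 0 i * v2r v 0 j.
Proof. by rewrite /tens mxE big_ord1 mxE. Qed.

Lemma tensDl u1 u2 v : tens (u1 + u2) v = tens u1 v + tens u2 v.
Proof. by apply/matrixP => i j; rewrite [RHS]mxE !tensE linearD mxE mulrDl. Qed.

Lemma tensDr u v1 v2 : tens u (v1 + v2) = tens u v1 + tens u v2.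
Proof. by apply/matrixP => i j; rewrite [RHS]mxE !tensE linearD mxE mulrDr. Qed.

Lemma tensZl c u v : tens (c *: u) v = c *: tens u v.
Proof. by apply/matrixP => i j; rewrite [RHS]mxE !tensE linearZ mxE mulrA. Qed.

Lemma tensZr c u v : tens u (c *: v) = c *: tens u v.
Proof. by apply/matrixP => i j; rewrite [RHS]mxE !tensE linearZ mxE mulrCA. Qed.

Lemma tens0l v : tens (0 : V) v = 0.
Proof. by rewrite -(scale0r 0) tensZl scale0r. Qed.

Lemma tens0r u : tens u (0 : W) = 0.
Proof. by rewrite -(scale0r 0) tensZr scale0r. Qed.

Lemma tens_suml I r (P : pred I) (F : I -> V) v :
  tens (\sum_(i <- r | P i) F i) v = \sum_(i <- r | P i) tens (F i) v.
Proof.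
by apply: (big_morph (fun u => tens u v)) => [u1 u2|]; rewrite ?tensDl ?tens0l.
Qed.

Lemma tens_sumr I r (P : pred I) (F : I -> W) u :
  tens u (\sum_(i <- r | P i) F i) = \sum_(i <- r | P i) tens u (F i).
Proof.
by apply: (big_morph (tens u)) => [v1 v2|]; rewrite ?tensDr ?tens0r.
Qed.

Lemma tens_eq0 u v : (tens u v == 0) = (u == 0) || (v == 0).
Proof.
apply/eqP/orP => [uv0 | [/eqP-> | /eqP->]]; rewrite ?tens0l ?tens0r //.
case: (eqVneq u 0) => [|u_neq0]; [by left | right].
have [i ui] : exists i, v2r u 0 i != 0.
  apply/existsP; apply: contraNT u_neq0; rewrite negb_exists => /forallP u0.
  rewrite -(inj_eq (can_inj v2rK)) linear0; apply/eqP/rowP => i.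
  by rewrite mxE; apply/eqP; rewrite -[_ == _]negbK u0.
rewrite -(inj_eq (can_inj v2rK)) linear0; apply/eqP/rowP => j.
have /eqP := congr1 (fun t : tensor V W => (t : 'M_(_, _)) i j) uv0.
by rewrite tensE !mxE mulf_eq0 (negbTE ui) => /eqP.
Qed.

Lemma stdvec_sum u : u = \sum_i v2r u 0 i *: stdvec i.
Proof.
by rewrite -{1}[u]v2rK {1}(row_sum_delta (v2r u)) linear_sum; apply: eq_bigr => i _;
   rewrite linearZ.
Qed.

Lemma tens_stdvec i j :
  tens (stdvec i : V) (stdvec j : W) = delta_mx i j :> 'M_(_, _).
Proof.
apply/matrixP => i' j'; rewrite tensE /stdvec !r2vK !mxE eqxx /=.
by rewrite -natrM mulnb.
Qed.

Lemma tensor_sum t :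
  t = \sum_i \sum_j (t : 'M_(_, _)) i j *: tens (stdvec i) (stdvec j).
Proof.
rewrite {1}[t](matrix_sum_delta (t : 'M_(_, _))).
by apply: eq_bigr => i _; apply: eq_bigr => j _; rewrite tens_stdvec.
Qed.

End TensorSpace.

Section TensorAlgebra.
Variables (k : fieldType) (A B : falgType k).
Implicit Types (a c : A) (b d : B) (s t : tensor A B).

Definition tensor_mul s t : tensor A B :=
  \sum_i \sum_j \sum_i' \sum_j'
    ((s : 'M_(_, _)) i j * (t : 'M_(_, _)) i' j') *:
      tens (stdvec i * stdvec i') (stdvec j * stdvec j').

Fact tensor_mulDl : left_distributive tensor_mul +%R.
Proof.
move=> s1 s2 t; rewrite /tensor_mul.
rewrite -big_split; apply: eq_bigr => i _ /=.
rewrite -big_split; apply: eq_bigr => j _ /=.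
rewrite -big_split; apply: eq_bigr => i' _ /=.
rewrite -big_split; apply: eq_bigr => j' _ /=.
by rewrite mxE mulrDl scalerDl.
Qed.

Fact tensor_mulDr : right_distributive tensor_mul +%R.
Proof.
move=> s t1 t2; rewrite /tensor_mul.
rewrite -big_split; apply: eq_bigr => i _ /=.
rewrite -big_split; apply: eq_bigr => j _ /=.
rewrite -big_split; apply: eq_bigr => i' _ /=.
rewrite -big_split; apply: eq_bigr => j' _ /=.
by rewrite mxE mulrDr scalerDl.
Qed.

Fact tensor_mulZl z s t : tensor_mul (z *: s) t = z *: tensor_mul s t.
Proof.
rewrite /tensor_mul; do 4![rewrite scaler_sumr; apply: eq_bigr => ? _].
by rewrite mxE scalerA mulrA.
Qed.

Fact tensor_mulZr z s t : tensor_mul s (z *: t) = z *: tensor_mul s t.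
Proof.
rewrite /tensor_mul; do 4![rewrite scaler_sumr; apply: eq_bigr => ? _].
by rewrite mxE scalerA mulrCA.
Qed.

Fact tensor_mul0l t : tensor_mul 0 t = 0.
Proof. by have := tensor_mulZl 0 0 t; rewrite !scale0r. Qed.

Fact tensor_mul0r s : tensor_mul s 0 = 0.
Proof. by have := tensor_mulZr 0 s 0; rewrite !scale0r. Qed.

Fact tensor_mul_suml I r (P : pred I) F t :
  tensor_mul (\sum_(i <- r | P i) F i) t
  = \sum_(i <- r | P i) tensor_mul (F i) t.
Proof.
apply: (big_morph (tensor_mul^~ t)) => [s1 s2|]; last exact: tensor_mul0l.
exact: tensor_mulDl.
Qed.

Fact tensor_mul_sumr I r (P : pred I) F s :
  tensor_mul s (\sum_(i <- r | P i) F i)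
  = \sum_(i <- r | P i) tensor_mul s (F i).
Proof.
apply: (big_morph (tensor_mul s)) => [t1 t2|]; last exact: tensor_mul0r.
exact: tensor_mulDr.
Qed.

Fact tensor_mul_tens a b c d :
  tensor_mul (tens a b) (tens c d) = tens (a * c) (b * d).
Proof.
rewrite {2}[a]stdvec_sum {2}[b]stdvec_sum {2}[c]stdvec_sum {2}[d]stdvec_sum.
rewrite /tensor_mul mulr_suml tens_suml; apply: eq_bigr => i _.
rewrite mulr_suml tens_sumr; apply: eq_bigr => j _.
rewrite mulr_sumr tens_suml; apply: eq_bigr => i' _.
rewrite mulr_sumr tens_sumr; apply: eq_bigr => j' _.
rewrite !tensE -!scalerAl -!scalerAr !(tensZl, tensZr) !scalerA.
by congr (_ *: _); rewrite !mulrA -!(mulrAC _ _ (v2r b 0 j)).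
Qed.

Lemma tensor_ind (P : tensor A B -> Prop) :
    P 0 -> (forall s t, P s -> P t -> P (s + t)) ->
    (forall a b, P (tens a b)) ->
  forall t, P t.
Proof.
move=> P0 PD Pt t; rewrite [t]tensor_sum.
by do 2![elim/big_ind: _ => // ? _]; rewrite -tensZl.
Qed.

Fact tensor_mulA : associative tensor_mul.
Proof.
move=> r s t; elim/tensor_ind: r => [|r1 r2 IH1 IH2|a b].
- by rewrite !tensor_mul0l.
- by rewrite !tensor_mulDl IH1 IH2.
elim/tensor_ind: s => [|s1 s2 IH1 IH2|a' b'].
- by rewrite !(tensor_mul0l, tensor_mul0r).
- by rewrite !(tensor_mulDl, tensor_mulDr) IH1 IH2.
elim/tensor_ind: t => [|t1 t2 IH1 IH2|a'' b''].
- by rewrite !tensor_mul0r.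
- by rewrite !tensor_mulDr IH1 IH2.
by rewrite !tensor_mul_tens !mulrA.
Qed.

Fact tensor_mul1l : left_id (tens 1 1 : tensor A B) tensor_mul.
Proof.
elim/tensor_ind => [|t1 t2 IH1 IH2|a b].
- by rewrite tensor_mul0r.
- by rewrite tensor_mulDr IH1 IH2.
by rewrite tensor_mul_tens !mul1r.
Qed.

Fact tensor_mul1r : right_id (tens 1 1 : tensor A B) tensor_mul.
Proof.
elim/tensor_ind => [|t1 t2 IH1 IH2|a b].
- by rewrite tensor_mul0l.
- by rewrite tensor_mulDl IH1 IH2.
by rewrite tensor_mul_tens !mulr1.
Qed.

Fact tensor_one_neq0 : (tens 1 1 : tensor A B) != 0.
Proof. by rewrite tens_eq0 !oner_eq0. Qed.

HB.instance Definition _ := GRing.Zmodule_isNzRing.Build (tensor A B)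
  tensor_mulA tensor_mul1l tensor_mul1r tensor_mulDl tensor_mulDr
  tensor_one_neq0.

Lemma tensM a b c d : tens a b * tens c d = tens (a * c) (b * d).
Proof. exact: tensor_mul_tens. Qed.

Lemma tens1 : tens 1 1 = 1 :> tensor A B.
Proof. by []. Qed.

End TensorAlgebra.

Section Coradical.
Variables (k : fieldType) (C : vectType k) (Delta : 'Hom(C, tensor C C)).

Definition subcoalgebra (D : {vspace C}) : Prop :=
  (Delta @: D <= tensv D D)%VS.

Definition simple_subcoalgebra (D : {vspace C}) : Prop :=
  [/\ subcoalgebra D, D <> 0%VS
    & forall E : {vspace C}, subcoalgebra E -> (E <= D)%VS ->
      E = 0%VS \/ E = D].

(* C0 is the sum of all the simple subcoalgebras of C. *)
Definition is_coradical (C0 : {vspace C}) : Prop :=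
  (forall D, simple_subcoalgebra D -> (D <= C0)%VS) /\
  (forall U : {vspace C},
    (forall D, simple_subcoalgebra D -> (D <= U)%VS) -> (C0 <= U)%VS).

(* The next term of the coradical filtration. *)
Definition coradical1 (C0 : {vspace C}) : {vspace C} :=
  (Delta @^-1: (tensv fullv C0 + tensv C0 fullv))%VS.

End Coradical.

Section Rank.
Variables (k : fieldType) (H : falgType k) (eps : 'Hom(H, k^o)).

(* k (x)_A M is the quotient of k (x)_k M = M by the span of the elements
   (1 . h) (x) m - 1 (x) (h m) = eps(h) m - h m, for h in A and m in M. *)
Definition balancing (A M : {vspace H}) : {vspace H} :=
  <<[seq (eps h : k) *: m - h * m | h <- vbasis A, m <- vbasis M]>>%VS.

Definition rank_one (Delta : 'Hom(H, tensor H H)) (H0 : {vspace H}) : Prop :=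
  let H1 := coradical1 Delta H0 in
  \dim H1 = (\dim (balancing H0 H1) + 2)%N.

End Rank.

Section Ideals.
Variables (k : fieldType) (A : falgType k).

(* Intended for a subalgebra S of A: its regular module is semisimple. *)
Definition semisimple_subalgebra (S : {vspace A}) : Prop :=
  forall U : {vspace A}, (U <= S)%VS -> (S * U <= U)%VS ->
  exists W : {vspace A},
    [/\ (W <= S)%VS, (S * W <= W)%VS, (U + W)%VS = S & (U :&: W)%VS = 0%VS].

Definition ideal2 (I : {vspace A}) : Prop :=
  (fullv * I <= I)%VS /\ (I * fullv <= I)%VS.

Definition ideal_summand (I : {vspace A}) : Prop :=
  ideal2 I /\
  exists J : {vspace A},
    [/\ ideal2 J, (I + J)%VS = fullv & (I :&: J)%VS = 0%VS].

Definition indecomposable_ideal (I : {vspace A}) : Prop :=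
  I <> 0%VS /\
  forall J K : {vspace A}, ideal2 J -> ideal2 K ->
    (J + K)%VS = I -> (J :&: K)%VS = 0%VS -> J = 0%VS \/ K = 0%VS.

Definition block (I : {vspace A}) : Prop :=
  ideal_summand I /\ indecomposable_ideal I.

(* A nonzero ideal direct summand is an algebra with its own unit, the
   component of 1 in it; so every block is an {aspace A}, and [subvs_of] it
   is the block as an algebra. *)
Lemma ideal_summand_aspace (I : {vspace A}) :
  ideal_summand I -> I <> 0%VS -> is_aspace I.
Proof.
case=> [[AI IA] [J [[AJ JA] IJ IJ0]]] In0.
have mulIJ u v : u \in I -> v \in J -> (u * v = 0) /\ (v * u = 0).
  move=> uI vJ; split; apply/eqP; rewrite -memv0 -IJ0 memv_cap.
    by rewrite (subvP IA) ?(subvP AJ) ?memv_mul ?memvf.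
  by rewrite (subvP AI) ?(subvP JA) ?memv_mul ?memvf.
have /memv_addP[e eI [f fJ ef]] : 1 \in (I + J)%VS by rewrite IJ memvf.
have e_l u : u \in I -> e * u = u.
  by move=> uI; rewrite -{2}[u]mul1r ef mulrDl (mulIJ u f uI fJ).2 addr0.
have e_r u : u \in I -> u * e = u.
  by move=> uI; rewrite -{2}[u]mulr1 ef mulrDr (mulIJ u f uI fJ).1 addr0.
apply/andP; split.
  apply/has_algidP; exists e; split=> //; last by move=> u uI; rewrite e_l ?e_r.
  apply/eqP => e0; apply: In0; apply/eqP; rewrite -subv0; apply/subvP => u uI.
  by rewrite memv0 -(e_l u uI) e0 mul0r.
exact: subv_trans (prodvSr I (subvf I)) IA.
Qed.

End Ideals.

(* A k-linear functor between the categories of all left modules.  The fields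
   [mf_id], [mf_comp] and [mf_lin] are stated for morphisms given up to
   pointwise equality, so that bundled linear maps with the same underlying
   function have the same image.  A scalar z of k acts on an A-module as
   z%:A. *)
Record mod_functor (k : fieldType) (A B : algType k) := ModFunctor {
  mf_obj :> lmodType A -> lmodType B;
  mf_map : forall M N : lmodType A,
    {linear M -> N} -> {linear mf_obj M -> mf_obj N};
  mf_id : forall (M : lmodType A) (f : {linear M -> M}),
    f =1 id -> mf_map f =1 id;
  mf_comp : forall (M N P : lmodType A) (f : {linear M -> N})
      (g : {linear N -> P}) (h : {linear M -> P}),
    h =1 g \o f -> mf_map h =1 mf_map g \o mf_map f;
  mf_lin : forall (M N : lmodType A) (z : k) (f g h : {linear M -> N}),
    (forall m, h m = z%:A *: f m + g m) ->
    forall m, mf_map h m = z%:A *: mf_map f m + mf_map g m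
}.

Definition inverse_mod_functors (k : fieldType) (A B : algType k)
    (F : mod_functor A B) (G : mod_functor B A) : Prop :=
  exists eta : forall M : lmodType A, {linear G (F M) -> M},
    (forall M, bijective (eta M)) /\
    (forall (M N : lmodType A) (f : {linear M -> N}),
      f \o eta M =1 eta N \o mf_map G (mf_map F f)).

Definition morita_equivalent (k : fieldType) (A B : algType k) : Prop :=
  exists (F : mod_functor A B) (G : mod_functor B A),
    inverse_mod_functors F G /\ inverse_mod_functors G F.

(* T is presented by generators g, y and the relations below: these relations
   make the g^i y^j with i, j < N span, so dimension N^2 says that there are
   no further relations. *)
Definition is_taft (k : fieldType) (N : nat) (q : k) (T : falgType k) : Prop :=
  N.-primitive_root q /\
  exists g y : T,
    [/\ g ^+ N = 1, y ^+ N = 0, g * y = q *: (y * g),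
        agenv <<[:: g; y]>> = fullv & \dim {:T} = (N ^ 2)%N].

(* A datum (G, chi, a, (alpha_{-1}, alpha_0, ..., alpha_{r-1})): G is the whole
   of gT, [pt] is a, [hgt] is r, [alpha_m1] is alpha_{-1}. *)
Record datum (k : fieldType) (gT : finGroupType) := Datum {
  chi : gT -> k;
  pt : gT;
  hgt : nat;
  alpha_m1 : k;
  alpha : 'I_hgt -> k
}.

Arguments alpha {k gT} d _.

Section FirstType.
Variables (k : fieldType) (gT : finGroupType) (p N : nat) (R : datum k gT).
Let a := pt R.
Let r := hgt R.
Let n := (p ^ r * N)%N.

Record admissible : Prop := Admissible {
  adm_chi_neq0 : forall g, chi R g != 0;
  adm_chiM : forall g h, chi R (g * h)%g = chi R g * chi R h;
  adm_center : a \in 'Z([set: gT])%g;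
  adm_chi_pt : chi R a != 1;
  adm_order : N.-primitive_root (chi R a);
  adm_alpha_m1 : (a ^+ n)%g = 1%g -> alpha_m1 R = 0;
  adm_alpha : forall i, alpha R i != 0 ->
    (a ^+ (N * (p ^ r - p ^ i)))%g = 1%g /\
    forall g, chi R g ^+ (N * (p ^ r - p ^ i)) = 1;
  adm_alpha_m1_chi : alpha_m1 R != 0 -> forall g, chi R g ^+ (N * p ^ r) = 1
}.

Variables (H : falgType k) (gr : gT -> H) (x : H)
  (Delta : 'Hom(H, tensor H H)) (eps : 'Hom(H, k^o)) (S : 'End(H)).

Record is_HR : Prop := IsHR {
  HR_gr1 : gr 1%g = 1;
  HR_grM : forall g h, gr (g * h)%g = gr g * gr h;
  HR_basis : basis_of {:H} [seq gr g * x ^+ i | g <- enum gT, i <- iota 0 n];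
  HR_conj : forall g, gr g * x * gr (g^-1)%g = chi R g *: x;
  HR_expn : x ^+ n = alpha_m1 R *: (gr a ^+ n - 1)
                     + \sum_(i < r) alpha R i *: x ^+ (p ^ i * N);
  HR_Delta : forall g i, (i < n)%N ->
    Delta (gr g * x ^+ i)
    = tens (gr g) (gr g) * (tens x (gr a) + tens 1 x) ^+ i;
  HR_eps : forall g i, (i < n)%N -> eps (gr g * x ^+ i) = (i == 0%N)%:R;
  HR_S : forall g i, (i < n)%N ->
    S (gr g * x ^+ i) = (- x * gr (a^-1)%g) ^+ i * gr (g^-1)%g
}.

(* The degree of y over H0: the least m with y^m in \sum_(i < m) H0 y^i. *)
Definition is_degree (H0 : {vspace H}) (y : H) (m : nat) : Prop :=
  y ^+ m \in (\sum_(i < m) H0 * <[y ^+ i]>)%VS /\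
  forall l, (l < m)%N -> y ^+ l \notin (\sum_(i < l) H0 * <[y ^+ i]>)%VS.

Definition nilpotent_type (H0 : {vspace H}) : Prop :=
  exists (y : H) (m : nat),
    [/\ Delta y = tens y (gr a) + tens 1 y,
        y \notin H0,
        exists z : k, gr a * y * gr (a^-1)%g = z *: y,
        is_degree H0 y m
      & y ^+ m = 0].

End FirstType.

(* Main.v *)
From HB Require Import structures.
Require Import Defs.
From mathcomp Require Import all_boot all_order all_algebra all_fingroup.
From mathcomp Require Import all_solvable all_field.
From mathcomp Require Import zify ring.

Set Implicit Arguments.
Unset Strict Implicit.
Unset Printing Implicit Defensive.
Import GRing.Theory.
Local Open Scope ring_scope.

(** Why the theorem holds.  Let [q = chi(a)], a primitive [N]-th root of unity.

    Reduction.  A nonzero subcoalgebra of [H] contains a grouplike element: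
    slice [Delta v] at a top power of [x] that occurs in [v].  Hence the
    coradical is [kG].  If [r] were positive, then [1], [x] and [x^N] would
    give three independent classes in [k (x)_{kG} H_1], since [x^N] is skew
    primitive by the vanishing of the Gaussian binomials at a root of unity;
    so rank one forces [r = 0], and [x^N = alpha_{-1} (a^N - 1)].  If
    [alpha_{-1}] were zero then [x] itself would witness the nilpotent type;
    so [alpha_{-1}] is nonzero and [chi^N = 1].

    What remains is the structure [skew_extension]: [H] is free over the
    semisimple algebra [S = kG] on [1, x, ..., x^(N-1)], and [x s = tau(s) x]
    where [tau] is the automorphism [g |-> chi(g)^-1 g] of [S], of order
    dividing [N].

    Blocks.  Let [e] be the unit of a block [B].  Semisimplicity and Schur's
    lemma give an idempotent [f] of [S] with [f S f = k f] and [f e <> 0].  The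
    central element [a] acts on [f] by a scalar [lam <> 0], hence on
    [f_i = tau^i(f)] by [lam q^i]; these scalars being distinct for [i < N], the
    [f_i] are orthogonal and [f_i S f_j = 0] for [i <> j].  Put
    [F = f_0 + ... + f_(N-1)].  Then [F H F] has basis [f_i x^j] ([i, j < N]),
    with [x f_i = f_{i+1} x] and [f_i x^N = b f_i] for the scalar
    [b = alpha_{-1} (lam^N - 1)].  After rescaling [x] one may take [b] to be
    0 or 1.  For [b = 0] this is the Taft algebra, whose idempotents are the
    eigenprojections of [g]; for [b = 1] it is [M_N(k)], with the [f_i x^j] as
    matrix units.

    The idempotent [F] lies in [B] because [e] acts on every [f_i] by the same
    scalar, and it is full in [B] because the sum of the [tau]-conjugates of the
    central idempotent generating [S f S] is central in [H] and lies in
    [H F H], so that it must act as the identity on the indecomposable [B].  So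
    [B] is Morita equivalent to its corner [F B F = F H F]
    ([morita_of_corner]). *)

(** * Module categories and full corners *)

(** A multiplicative linear map from [B] to matrices over [A] that need
    not preserve 1.  It turns an [A]-module [M] into a [B]-module, namely the
    image of the idempotent [phi 1] on [M^I].  Both functors of a Morita
    equivalence between an algebra and a full corner of it have this form, which
    avoids tensor products of infinite dimensional modules. *)
Record matrix_rep (k : fieldType) (A B : algType k) (I : finType) := MatrixRep {
  mrep :> B -> I -> I -> A;
  mrepP : forall z b c i j, mrep (z *: b + c) i j = z *: mrep b i j + mrep c i j;
  mrepM : forall b c i j, mrep (b * c) i j = \sum_l mrep b i l * mrep c l j
}.

Section RepAction.
Variables (k : fieldType) (A B : algType k) (I : finType).
Variable phi : matrix_rep A B I.

Lemma mrepD b c i j : phi (b + c) i j = phi b i j + phi c i j.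
Proof. by rewrite -[b]scale1r mrepP !scale1r. Qed.

Lemma mrep0 i j : phi 0 i j = 0.
Proof. by apply: (@addrI _ (phi 0 i j)); rewrite -mrepD !addr0. Qed.

Lemma mrepZ z b i j : phi (z *: b) i j = z *: phi b i j.
Proof. by rewrite -[z *: b]addr0 mrepP mrep0 addr0. Qed.

Definition rep_act (M : lmodType A) (b : B) (v : {ffun I -> M}) :
  {ffun I -> M} := [ffun i => \sum_j phi b i j *: v j].

Definition rep_image (M : lmodType A) : {pred {ffun I -> M}} :=
  fun v => rep_act 1 v == v.
Arguments rep_image M : clear implicits.

Lemma rep_actD (M : lmodType A) b (u v : {ffun I -> M}) :
  rep_act b (u + v) = rep_act b u + rep_act b v.
Proof.
apply/ffunP => i; rewrite !ffunE -big_split; apply: eq_bigr => j _.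
by rewrite ffunE scalerDr.
Qed.

Lemma rep_actN (M : lmodType A) b (u : {ffun I -> M}) :
  rep_act b (- u) = - rep_act b u.
Proof.
by apply/ffunP => i; rewrite !ffunE -sumrN; apply: eq_bigr => j _;
   rewrite ffunE scalerN.
Qed.

Lemma rep_actM (M : lmodType A) b c (v : {ffun I -> M}) :
  rep_act b (rep_act c v) = rep_act (b * c) v.
Proof.
apply/ffunP => i; rewrite !ffunE.
under eq_bigr do rewrite ffunE scaler_sumr.
rewrite exchange_big /=; apply: eq_bigr => j _; rewrite mrepM scaler_suml.
by apply: eq_bigr => l _; rewrite scalerA.
Qed.

Fact rep_image_zmod (M : lmodType A) : zmod_closed (rep_image M).
Proof.
split=> [|u v /eqP uP /eqP vP]; apply/eqP.
  by apply/ffunP => i; rewrite !ffunE big1 // => j _; rewrite ffunE scaler0.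
by rewrite rep_actD rep_actN uP vP.
Qed.

HB.instance Definition _ (M : lmodType A) :=
  GRing.isZmodClosed.Build _ (rep_image M) (rep_image_zmod M).

Record rep_module (M : lmodType A) : Type :=
  RepModule { rep_val : {ffun I -> M}; _ : rep_val \in rep_image M }.
Arguments RepModule {M} rep_val _.

HB.instance Definition _ (M : lmodType A) := [isSub of rep_module M for @rep_val M].
HB.instance Definition _ (M : lmodType A) := [Choice of rep_module M by <:].
HB.instance Definition _ (M : lmodType A) :=
  [SubChoice_isSubZmodule of rep_module M by <:].

Lemma rep_val_inj (M : lmodType A) : injective (@rep_val M).
Proof. exact: val_inj. Qed.

Lemma rep_valD (M : lmodType A) (u v : rep_module M) :
  rep_val (u + v) = rep_val u + rep_val v.
Proof. by []. Qed.

Lemma rep_val_sum (M : lmodType A) J (r : seq J) (v : J -> rep_module M) i :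
  rep_val (\sum_(j <- r) v j) i = \sum_(j <- r) rep_val (v j) i.
Proof.
by elim/big_rec2: _ => [|j u w _ <-]; rewrite /= ?ffunE.
Qed.

Lemma rep_moduleP (M : lmodType A) (v : rep_module M) :
  rep_act 1 (rep_val v) = rep_val v.
Proof. by case: v => v /= /eqP. Qed.

Fact rep_act_image (M : lmodType A) b (v : {ffun I -> M}) :
  rep_act b v \in rep_image M.
Proof. by apply/eqP; rewrite rep_actM mul1r. Qed.

Definition rep_scale (M : lmodType A) (b : B) (v : rep_module M) :
  rep_module M := RepModule (rep_act b (rep_val v)) (rep_act_image b (rep_val v)).

Fact rep_scaleA (M : lmodType A) b c (v : rep_module M) :
  rep_scale b (rep_scale c v) = rep_scale (b * c) v.
Proof. by apply: rep_val_inj; rewrite /= rep_actM. Qed.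

Fact rep_scale1 (M : lmodType A) : left_id 1 (@rep_scale M).
Proof. by move=> v; apply: rep_val_inj; rewrite /= rep_moduleP. Qed.

Fact rep_scaleDr (M : lmodType A) : right_distributive (@rep_scale M) +%R.
Proof. by move=> b u v; apply: rep_val_inj; rewrite [RHS]rep_valD /= -rep_actD. Qed.

Fact rep_scaleDl (M : lmodType A) (v : rep_module M) :
  {morph (@rep_scale M)^~ v : b c / b + c}.
Proof.
move=> b c; apply: rep_val_inj; rewrite [RHS]rep_valD; apply/ffunP => i.
by rewrite !ffunE -big_split; apply: eq_bigr => j _; rewrite mrepD scalerDl.
Qed.

HB.instance Definition _ (M : lmodType A) :=
  GRing.Zmodule_isLmodule.Build B (rep_module M)
    (@rep_scaleA M) (@rep_scale1 M) (@rep_scaleDr M) (@rep_scaleDl M).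

Lemma rep_moduleE (M : lmodType A) b (v : rep_module M) i :
  rep_val (b *: v) i = \sum_j phi b i j *: rep_val v j.
Proof. by rewrite /= ffunE. Qed.

Section RepMap.
Variables (M N : lmodType A) (f : {linear M -> N}).

Fact rep_map_image (v : rep_module M) :
  [ffun i => f (rep_val v i)] \in rep_image N.
Proof.
apply/eqP/ffunP => i; rewrite !ffunE.
have /ffunP/(_ i) := rep_moduleP v; rewrite !ffunE => <-.
by rewrite linear_sum; apply: eq_bigr => j _; rewrite ffunE linearZ.
Qed.

Definition rep_map (v : rep_module M) : rep_module N :=
  RepModule [ffun i => f (rep_val v i)] (rep_map_image v).

Lemma rep_mapE v i : rep_val (rep_map v) i = f (rep_val v i).
Proof. by rewrite /= ffunE. Qed.

Fact rep_map_is_linear : linear rep_map.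
Proof.
move=> b u v; apply: rep_val_inj; apply/ffunP => i.
rewrite rep_mapE [RHS]ffunE rep_valD ffunE linearD !rep_moduleE linear_sum.
congr (_ + _); last by rewrite rep_mapE.
by apply: eq_bigr => j _; rewrite rep_mapE linearZ.
Qed.

HB.instance Definition _ :=
  GRing.isLinear.Build B (rep_module M) (rep_module N) _ rep_map
    rep_map_is_linear.

End RepMap.

Definition rep_functor : mod_functor A B.
Proof.
apply: (@ModFunctor k A B rep_module
          (fun M N f => rep_map f : {linear rep_module M -> rep_module N})).
- move=> M f fid v; apply: rep_val_inj; apply/ffunP => i.
  by rewrite rep_mapE fid.
- move=> M N P f g h hE v; apply: rep_val_inj; apply/ffunP => i.
  by rewrite /= !ffunE hE.
move=> M N z f g h hE v; apply: rep_val_inj; apply/ffunP => i.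
rewrite rep_mapE hE rep_valD ffunE rep_moduleE rep_mapE; congr (_ + _).
have /ffunP/(_ i) := rep_moduleP v; rewrite !ffunE => <-.
rewrite linear_sum scaler_sumr; apply: eq_bigr => j _.
by rewrite rep_mapE linearZ scalerA mrepZ mulr_algl.
Defined.

End RepAction.
Arguments RepModule {k A B I phi M} rep_val _.
Arguments rep_image {k A B I} phi M _.

(** The data [w], [w'] identify [A], as an [A]-bimodule, with the
    composite of the two representations: [w] glues the coordinates of
    [psi(1) phi(1) M^(J x I)] into one element of [M], and [w'] recovers
    them. *)
Lemma rep_functor_inverse (k : fieldType) (A B : algType k) (I J : finType)
    (phi : matrix_rep A B I) (psi : matrix_rep B A J)
    (w w' : J -> I -> A) :
    \sum_j \sum_i w j i * w' j i = 1 ->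
    (forall a j i j1 i1,
      w' j i * a * w j1 i1 = phi (psi a j j1) i i1) ->
  inverse_mod_functors (rep_functor phi) (rep_functor psi).
Proof.
move=> ww1 w'aw.
pose F (M : lmodType A) : lmodType B := rep_module phi M.
pose G (M : lmodType B) : lmodType A := rep_module psi M.
pose e (M : lmodType A) (v : G (F M)) : M :=
  \sum_j \sum_i w j i *: rep_val (rep_val v j) i.
have e_act M a (v : G (F M)) : e M (a *: v) = a *: e M v.
  rewrite /e scaler_sumr.
  under eq_bigr => j _ do under eq_bigr => i _ do
    rewrite rep_moduleE rep_val_sum scaler_sumr.
  transitivity (\sum_j \sum_i \sum_j1 \sum_i1
    (w j i * w' j i) *: ((a * w j1 i1) *: rep_val (rep_val v j1) i1)).
    apply: eq_bigr => j _; apply: eq_bigr => i _; apply: eq_bigr => j1 _.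
    rewrite rep_moduleE scaler_sumr; apply: eq_bigr => i1 _.
    by rewrite !scalerA -w'aw !mulrA.
  under eq_bigr => j _ do under eq_bigr => i _ do
    (under eq_bigr do rewrite -scaler_sumr; rewrite -scaler_sumr).
  under eq_bigr do rewrite -scaler_suml.
  rewrite -scaler_suml ww1 scale1r; apply: eq_bigr => j _.
  by rewrite scaler_sumr; apply: eq_bigr => i _; rewrite scalerA.
have e_lin M : linear (e M).
  move=> a u v; rewrite -e_act /e -big_split; apply: eq_bigr => j _ /=.
  rewrite -big_split; apply: eq_bigr => i _ /=.
  by rewrite !ffunE -scalerDr.
pose eL M : {linear G (F M) -> M} :=
  HB.pack (e M) (GRing.isLinear.Build A (G (F M)) M _ (e M) (e_lin M)).
exists eL; split=> [M | M N f v /=]; last first.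
  rewrite /e linear_sum; apply: eq_bigr => j _.
  rewrite linear_sum; apply: eq_bigr => i _.
  by rewrite !rep_mapE linearZ.
have w1 m : \sum_j \sum_i (w j i * w' j i) *: (m : M) = m.
  by under eq_bigr do rewrite -scaler_suml; rewrite -scaler_suml ww1 scale1r.
have w'E j i (m : M) :
  \sum_j1 \sum_i1 phi (psi 1 j j1) i i1 *: (w' j1 i1 *: m) = w' j i *: m.
  rewrite -{2}[m]w1 scaler_sumr; apply: eq_bigr => j1 _.
  rewrite scaler_sumr; apply: eq_bigr => i1 _.
  by rewrite -w'aw mulr1 !scalerA mulrA.
have phi1 b i i1 : \sum_i2 phi 1 i i2 * phi b i2 i1 = phi b i i1.
  by rewrite -mrepM mul1r.
have in1 (m : M) j : [ffun i => w' j i *: m] \in rep_image phi M.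
  apply/eqP/ffunP => i; rewrite !ffunE.
  under eq_bigr => i1 _.
    rewrite ffunE -w'E scaler_sumr.
    under eq_bigr do rewrite scaler_sumr.
    over.
  rewrite exchange_big /= -w'E; apply: eq_bigr => j1 _.
  rewrite exchange_big /=; apply: eq_bigr => i1 _.
  rewrite -phi1 scaler_suml; apply: eq_bigr => i2 _.
  by rewrite scalerA.
pose c (m : M) j : F M := RepModule [ffun i => w' j i *: m] (in1 m j).
have in2 (m : M) : [ffun j => c m j] \in rep_image psi (F M).
  apply/eqP/ffunP => j; apply: rep_val_inj; apply/ffunP => i.
  rewrite !ffunE /= rep_val_sum -w'E.
  apply: eq_bigr => j1 _; rewrite ffunE rep_moduleE; apply: eq_bigr => i1 _.
  by rewrite /= ffunE.
exists (fun m => RepModule [ffun j => c m j] (in2 m)) => [v | m].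
  apply: rep_val_inj; apply/ffunP => j; apply: rep_val_inj; apply/ffunP => i.
  rewrite /= !ffunE /= /e.
  have := congr1 (fun u : {ffun J -> F M} => rep_val (u j) i) (rep_moduleP v).
  rewrite ffunE rep_val_sum => <-.
  rewrite scaler_sumr; apply: eq_bigr => j1 _.
  rewrite rep_moduleE scaler_sumr; apply: eq_bigr => i1 _.
  by rewrite scalerA -w'aw mulr1.
rewrite /= /e -[RHS]w1; apply: eq_bigr => j _; apply: eq_bigr => i _.
by rewrite ffunE /= ffunE scalerA.
Qed.

(** Here [psi] identifies [T] with the corner [F A F], [F = psi 1],
    and the last hypothesis says that [F] is full.  One functor sends [M] to
    [F M]; in the other direction [a] acts through the matrix of the
    [v_i a u_j], read in the corner. *)
Lemma morita_of_corner (k : fieldType) (A T : algType k) (I : finType)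
    (psi : {linear T -> A}) (u v : I -> A) :
    {morph psi : s t / s * t} -> injective psi ->
    (forall a, exists t, psi t = psi 1 * a * psi 1) ->
    \sum_i u i * psi 1 * v i = 1 ->
  morita_equivalent A T.
Proof.
move=> psiM psiI psi_onto uv1.
have psi_ontob a : exists t, psi t == psi 1 * a * psi 1.
  by have [t /eqP] := psi_onto a; exists t.
(* rho is the compression a |-> F a F, read in T *)
pose rho a := xchoose (psi_ontob a).
have rhoE a : psi (rho a) = psi 1 * a * psi 1 by exact/eqP/(xchooseP (psi_ontob a)).
have psi1l t : psi 1 * psi t = psi t by rewrite -psiM mul1r.
have psi1r t : psi t * psi 1 = psi t by rewrite -psiM mulr1.
pose phi b i j := rho (v i * b * u j).
have phiP z b c i j : phi (z *: b + c) i j = z *: phi b i j + phi c i j.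
  apply: psiI; rewrite linearP /= !rhoE !(mulrDr, mulrDl).
  by rewrite -!(scalerAl, scalerAr).
have phiM b c i j : phi (b * c) i j = \sum_l phi b i l * phi c l j.
  apply: psiI; rewrite linear_sum rhoE -{1}[b]mulr1 -uv1.
  rewrite !(mulr_sumr, mulr_suml).
  apply: eq_bigr => l _ /=; rewrite psiM !rhoE.
  by rewrite !mulrA -[_ * psi 1 * psi 1]mulrA psi1l.
pose Phi := MatrixRep phiP phiM.
have PsiP z s t (i j : unit) : psi (z *: s + t) = z *: psi s + psi t.
  by rewrite linearP.
have PsiM s t (i j : unit) : psi (s * t) = \sum_(l : unit) psi s * psi t.
  by rewrite big_const card_unit /= addr0 psiM.
pose Psi := @MatrixRep k A T unit (fun t _ _ => psi t) PsiP PsiM.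
exists (rep_functor Psi), (rep_functor Phi); split.
  apply: (@rep_functor_inverse k A T unit I Psi Phi
            (fun i _ => u i * psi 1) (fun i _ => psi 1 * v i)) => [|a i [] j []].
    rewrite -[RHS]uv1; apply: eq_bigr => i _.
    by rewrite big_const card_unit /= addr0 mulrA -[_ * psi 1 * psi 1]mulrA psi1l.
  by rewrite /= rhoE !mulrA.
apply: (@rep_functor_inverse k T A I unit Phi Psi
          (fun _ i => rho (u i)) (fun _ i => rho (v i))) => [|t [] i [] j].
  rewrite big_const card_unit /= addr0; apply: psiI; rewrite linear_sum.
  transitivity (psi 1 * 1 * psi 1); last by rewrite mulr1 psi1l.
  rewrite -[X in _ * X * _]uv1 mulr_sumr mulr_suml; apply: eq_bigr => i _ /=.
  by rewrite psiM !rhoE !mulrA -[_ * u i * psi 1 * psi 1]mulrA psi1l.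
apply: psiI; rewrite /= !psiM !rhoE -!mulrA (mulrA (psi 1) (psi t)) psi1l.
by rewrite (mulrA (psi t)) psi1r !mulrA.
Qed.

(** Two families indexed like matrix units, with the same
    structure constants [w]: the one in [T] is a basis with coordinates [ct],
    the one in [A] is a basis of a full corner. *)
Lemma morita_of_matrix_families (k : fieldType) (A T : algType k) (I J : finType)
    (w : I -> I -> I -> k) (b : I -> I -> A) (t : I -> I -> T)
    (ct : I -> I -> T -> k) (u v : J -> A) :
    (forall i j i' j',
       b i j * b i' j' = (if j == i' then w i j j' else 0) *: b i j') ->
    (forall i j i' j',
       t i j * t i' j' = (if j == i' then w i j j' else 0) *: t i j') ->
    (forall i j, scalar (ct i j)) ->
    (forall i j i' j', ct i j (t i' j') = ((i == i') && (j == j'))%:R) ->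
    (forall s, s = \sum_i \sum_j ct i j s *: t i j) ->
    \sum_i t i i = 1 ->
    (forall x : I -> I -> k,
       \sum_i \sum_j x i j *: b i j = 0 -> forall i j, x i j = 0) ->
    (forall a, exists x : I -> I -> k,
       (\sum_i b i i) * a * (\sum_i b i i) = \sum_i \sum_j x i j *: b i j) ->
    \sum_l u l * (\sum_i b i i) * v l = 1 ->
  morita_equivalent A T.
Proof.
move=> bM tM ct_lin ct_t tE t1 b_free b_span uv1.
pose psi s := \sum_i \sum_j ct i j s *: b i j.
have psi_lin : linear psi.
  move=> z s s'; rewrite /psi scaler_sumr -big_split; apply: eq_bigr => i _ /=.
  rewrite scaler_sumr -big_split; apply: eq_bigr => j _ /=.
  by rewrite ct_lin scalerDl scalerA.
pose psiL : {linear T -> A} :=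
  HB.pack psi (GRing.isLinear.Build k T A _ psi psi_lin).
have psi_t i j : psiL (t i j) = b i j.
  rewrite /= /psi (bigD1 i) //= (bigD1 j) //= ct_t !eqxx scale1r.
  rewrite !big1 ?addr0 // => [i' i'i|j' j'j].
    by rewrite big1 // => j' _; rewrite ct_t (negbTE i'i) scale0r.
  by rewrite ct_t (negbTE j'j) andbF scale0r.
have psiE s : psiL s = \sum_i \sum_j ct i j s *: b i j by [].
have psi1 : psiL 1 = \sum_i b i i.
  by rewrite -t1 linear_sum; apply: eq_bigr => i _; apply: psi_t.
have psi_ct (c : I -> I -> k) :
  psiL (\sum_i \sum_j c i j *: t i j) = \sum_i \sum_j c i j *: b i j.
  rewrite linear_sum; apply: eq_bigr => i _.
  by rewrite linear_sum; apply: eq_bigr => j _; rewrite linearZ psi_t.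
apply: (@morita_of_corner k A T J psiL u v).
- move=> s s'; rewrite [s]tE [s']tE !psi_ct.
  rewrite !(mulr_suml, linear_sum); apply: eq_bigr => i _.
  rewrite !(mulr_suml, linear_sum); apply: eq_bigr => j _.
  rewrite !(mulr_sumr, linear_sum); apply: eq_bigr => i' _.
  rewrite !(mulr_sumr, linear_sum); apply: eq_bigr => j' _.
  rewrite -!(scalerAl, scalerAr) tM bM !linearZ psi_t.
  by rewrite /= !scalerA [in RHS]mulrC mulrA.
- move=> s s' /eqP; rewrite -subr_eq0 -linearB psiE => /eqP/b_free ss'.
  apply/eqP; rewrite -subr_eq0 [s - s']tE big1 // => i _.
  by rewrite big1 // => j _; rewrite ss' scale0r.
- move=> a; have [x xE] := b_span a.
  by exists (\sum_i \sum_j x i j *: t i j); rewrite psi_ct psi1 -xE.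
by rewrite psi1.
Qed.

(** * Matrix units from a cyclic system of idempotents *)

Section CyclicSystem.
Variables (k : fieldType) (A : algType k) (N : nat) (f : nat -> A) (y : A).
Variable beta : k.
Hypothesis N_gt0 : (0 < N)%N.
Hypothesis f_per : forall i, f (i + N) = f i.
Hypothesis f_orth : forall i j, (i < N)%N -> (j < N)%N ->
  f i * f j = (i == j)%:R *: f i.
Hypothesis f_shift : forall i, y * f i = f i.+1 * y.
Hypothesis f_expN : forall i, f i * y ^+ N = beta *: f i.

(** The exponent of [y] needed to go from index [j] to index [i]
    around the cycle of length [N]. *)
Definition cyc_dist (i j : nat) : nat := ((i + N - j) %% N)%N.
(** The analogue of the matrix unit [e_ij]: by the relation
    [y f_i = f_{i+1} y], left multiplication by it moves the range of [f j] to
    the range of [f i]. *)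
Definition cyc_unit (i j : nat) : A := f i * y ^+ cyc_dist i j.
(** The path from [l] through [j] to [i] runs past the starting point
    exactly when the two distances add up to at least [N]; this costs a factor
    [y^N], which acts as [beta]. *)
Definition cyc_coef (i j l : nat) : k :=
  if (cyc_dist i j + cyc_dist j l < N)%N then 1 else beta.

Lemma f_mod i : f (i %% N) = f i.
Proof.
rewrite {2}(divn_eq i N) addnC; elim: (i %/ N)%N => [|m IHm].
  by rewrite addn0.
by rewrite mulSn addnCA addnC f_per.
Qed.

Lemma f_shiftX m i : y ^+ m * f i = f (i + m) * y ^+ m.
Proof.
elim: m => [|m IHm]; first by rewrite expr0 mul1r mulr1 addn0.
by rewrite exprS -mulrA IHm mulrA f_shift -mulrA addnS.
Qed.

Lemma cyc_distD i j l : (i < N)%N -> (j < N)%N -> (l < N)%N ->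
  cyc_dist i l = ((cyc_dist i j + cyc_dist j l) %% N)%N.
Proof.
move=> iN jN lN; rewrite /cyc_dist modnDm.
have -> : (i + N - j + (j + N - l) = (i + N - l) + N)%N by lia.
by rewrite modnDr.
Qed.

(** [cyc_dist i j] is the only shift, modulo [N], that takes [j]
    to [i]. *)
Lemma cyc_dist_shift i j m : (i < N)%N -> (j < N)%N -> (m < N)%N ->
  ((m + cyc_dist i j) %% N == i)%N = (m == j).
Proof.
move=> iN jN mN; have e : ((j + cyc_dist i j) %% N = i)%N.
  rewrite /cyc_dist modnDmr; have -> : (j + (i + N - j) = i + N)%N by lia.
  by rewrite modnDr modn_small.
by rewrite -{2}e eqn_modDr !modn_small.
Qed.

Lemma cyc_distii i : (i < N)%N -> cyc_dist i i = 0.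
Proof. by move=> iN; rewrite /cyc_dist addKn modnn. Qed.

Lemma cyc_unitii i : (i < N)%N -> cyc_unit i i = f i.
Proof. by move=> iN; rewrite /cyc_unit cyc_distii // mulr1. Qed.

(** Moving [f i'] to the left across [y^d] turns it into [f (i' + d)],
    which meets [f i] only for [i' = j]. *)
Lemma cyc_unitM i j i' j' :
    (i < N)%N -> (j < N)%N -> (i' < N)%N -> (j' < N)%N ->
  cyc_unit i j * cyc_unit i' j'
  = (if j == i' then cyc_coef i j j' else 0) *: cyc_unit i j'.
Proof.
move=> iN jN i'N j'N; rewrite /cyc_unit mulrA -(mulrA (f i)) f_shiftX.
rewrite -(f_mod (i' + _)) mulrA f_orth ?ltn_mod // [i == _]eq_sym cyc_dist_shift //.
rewrite [i' == j]eq_sym; case: eqP => [<-|_]; last by rewrite !scale0r !mul0r.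
rewrite scale1r -mulrA -exprD (@cyc_distD i j j') // /cyc_coef.
have dN a b : (cyc_dist a b < N)%N by rewrite ltn_mod.
have := dN i j; have := dN j j'; set d := cyc_dist i j; set d' := cyc_dist j j'.
move=> d'N d1N; case: ltnP => dd'; first by rewrite scale1r modn_small.
have -> : (d + d' = N + (d + d') %% N)%N.
  have {2}-> : (d + d' = d + d' - N + N)%N by lia.
  by rewrite modnDr modn_small; lia.
by rewrite exprD mulrA f_expN -scalerAl modnDl modn_mod.
Qed.

End CyclicSystem.

(** * Gaussian binomials and tensor products *)

Section GaussianBinomial.
Variables (k : fieldType) (Q : k).

(** The Gaussian binomial coefficients at [Q], through their Pascal
    rule. *)
Fixpoint gauss_bin (n j : nat) : k :=
  match n, j with
  | n'.+1, j'.+1 => gauss_bin n' j' + Q ^+ j'.+1 * gauss_bin n' j'.+1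
  | _, 0 => 1
  | 0, _ => 0
  end.

Lemma gauss_bin0 n : gauss_bin n 0 = 1.
Proof. by case: n. Qed.

Lemma gauss_bin_small n j : (n < j)%N -> gauss_bin n j = 0.
Proof.
elim: n j => [|n IHn] [|j] //= nj.
by rewrite !IHn ?mulr0 ?addr0 //; lia.
Qed.

Lemma gauss_bin_diag n : gauss_bin n n = 1.
Proof. by elim: n => //= n ->; rewrite gauss_bin_small // mulr0 addr0. Qed.

(** The division-free form of the quotient of two consecutive
    coefficients. *)
Lemma gauss_bin_ratio n j : (j <= n)%N ->
  gauss_bin n j.+1 * (Q ^+ j.+1 - 1) = gauss_bin n j * (Q ^+ (n - j) - 1).
Proof.
elim: n j => [|n IHn] j.
  by rewrite leqn0 => /eqP->; rewrite subnn expr0 subrr mulr0 mul0r.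
rewrite leq_eqVlt => /orP[/eqP->|].
  by rewrite gauss_bin_small // subnn expr0 subrr mulr0 mul0r.
rewrite ltnS => jn; rewrite /= mulrDl -mulrA IHn //.
have -> : gauss_bin n j * (Q ^+ j.+1 - 1)
          + Q ^+ j.+1 * (gauss_bin n j * (Q ^+ (n - j) - 1))
        = gauss_bin n j * (Q ^+ n.+1 - 1).
  have -> : n.+1 = (j.+1 + (n - j))%N by lia.
  rewrite exprD; ring.
case: j jn => [|j] jn; first by rewrite !gauss_bin0 subn0.
rewrite /= mulrDl subSS -IHn; last by lia.
have -> : n.+1 = (j.+1 + (n - j))%N by lia.
rewrite exprD; ring.
Qed.

(** The ratio identity starts, for [j = 0], with the factor
    [Q^n - 1 = 0]; afterwards [Q^(j+1) - 1] is invertible, so the vanishing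
    propagates up to [j = n - 1]. *)
Lemma gauss_bin_root n j : n.-primitive_root Q -> (0 < j < n)%N ->
  gauss_bin n j = 0.
Proof.
move=> Qn; elim: j => // j IHj /= jn.
have gj0 : gauss_bin n j * (Q ^+ (n - j) - 1) = 0.
  case: j jn IHj => [|j] jn IHj; last by rewrite IHj ?mul0r //= ltnW.
  by rewrite subn0 prim_expr_order // subrr mulr0.
have /eqP := gauss_bin_ratio (ltnW (ltnW jn)).
rewrite gj0 mulf_eq0 => /orP[/eqP //|].
rewrite subr_eq0 -(prim_order_dvd Qn) => /(dvdn_leq (ltn0Sn j)).
by rewrite leqNgt jn.
Qed.

End GaussianBinomial.

Lemma scalar_expr_comm (k : fieldType) (A : algType k) (q : k) (g x : A) j :
  g * x = q *: (x * g) -> g ^+ j * x = q ^+ j *: (x * g ^+ j).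
Proof.
move=> gx; elim: j => [|j IHj]; first by rewrite !expr0 mul1r mulr1 scale1r.
rewrite [in LHS]exprS -mulrA IHj -scalerAr mulrA gx -scalerAl scalerA -mulrA.
by rewrite -!exprS -exprSr.
Qed.

Section TensorTools.
Variables (k : fieldType) (V W : vectType k).

Lemma memv_tens (U : {vspace V}) (U' : {vspace W}) u v :
  u \in U -> v \in U' -> tens u v \in tensv U U'.
Proof.
move=> uU vU'; rewrite (coord_vbasis uU) (coord_vbasis vU').
rewrite tens_suml memv_suml // => i _; rewrite tens_sumr memv_suml // => j _.
rewrite tensZl tensZr !memvZ // memv_span //.
by apply/allpairsP; exists ((vbasis U)`_i, (vbasis U')`_j);
   rewrite /= !mem_nth ?size_tuple.
Qed.

Lemma tensv_subP (U : {vspace V}) (U' : {vspace W}) (X : {vspace tensor V W}) :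
  (forall u v, u \in U -> v \in U' -> tens u v \in X) -> (tensv U U' <= X)%VS.
Proof.
move=> UX; apply/span_subvP => _ /allpairsP[[u v] /= [uU vU' ->]].
by apply: UX; apply: vbasis_mem.
Qed.

Variable phi : {linear V -> k^o}.

(** The map [phi (x) id], written in the coordinates of the tensor
    product. *)
Definition slice (t : tensor V W) : W :=
  \sum_i \sum_j ((t : 'M_(_, _)) i j * (phi (stdvec i) : k)) *: stdvec j.

Fact slice_is_linear : linear slice.
Proof.
move=> z s t; rewrite /slice scaler_sumr -big_split; apply: eq_bigr => i _ /=.
rewrite scaler_sumr -big_split; apply: eq_bigr => j _ /=.
by rewrite !mxE mulrDl scalerDl scalerA mulrA.
Qed.

HB.instance Definition _ :=
  GRing.isLinear.Build k (tensor V W) W _ slice slice_is_linear.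

Lemma slice_tens u v : slice (tens u v) = (phi u : k) *: v.
Proof.
rewrite {2}[u]stdvec_sum {2}[v]stdvec_sum [phi _]linear_sum scaler_suml.
apply: eq_bigr => i _; rewrite scaler_sumr; apply: eq_bigr => j _.
by rewrite tensE scalerA linearZ /= mulrAC.
Qed.

Lemma slice_mem (U : {vspace V}) (U' : {vspace W}) t :
  t \in tensv U U' -> slice t \in U'.
Proof.
suff /subvP : (tensv U U' <= linfun slice @^-1: U')%VS.
  by move=> sU /sU; rewrite -memv_preim lfunE.
apply: tensv_subP => u v uU vU'.
by rewrite -memv_preim lfunE /= slice_tens memvZ.
Qed.

End TensorTools.

(** The quantum binomial formula for the two summands [x (x) g]
    and [1 (x) x] of the coproduct of [x], which commute up to [q]. *)
Lemma skew_primitive_expr (k : fieldType) (H : falgType k) (q : k) (g x : H) n :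
    q != 0 -> g * x = q *: (x * g) ->
  (tens x g + tens 1 x) ^+ n =
  \sum_(j < n.+1)
    tens (x ^+ j) (gauss_bin q^-1 n j *: (g ^+ j * x ^+ (n - j))).
Proof.
move=> q0 gx; elim: n => [|n IHn].
  by rewrite big_ord1 !expr0 /= mulr1 scale1r.
rewrite exprS IHn mulr_sumr.
transitivity (\sum_(j < n.+1)
    (tens (x ^+ j.+1)
       (gauss_bin q^-1 n j *: (g ^+ j.+1 * x ^+ (n - j)))
     + tens (x ^+ j) ((q^-1 ^+ j * gauss_bin q^-1 n j)
         *: (g ^+ j * x ^+ (n.+1 - j))))).
  apply: eq_bigr => j _; rewrite mulrDl !tensM mul1r -exprS.
  rewrite -!scalerAr mulrA -exprS; congr (_ + _).
  have xg : x * g ^+ j = q^-1 ^+ j *: (g ^+ j * x).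
    by rewrite (scalar_expr_comm j gx) scalerA -exprMn mulVf // expr1n scale1r.
  rewrite mulrA xg -scalerAl scalerA mulrC -mulrA -exprS -subSn //.
  by rewrite -ltnS.
rewrite big_split /= [RHS]big_ord_recl /= subn0.
rewrite [X in _ + X]big_ord_recl gauss_bin0 /= subn0 mulr1 addrCA.
congr (_ + _).
transitivity (\sum_(i < n.+1) tens (x ^+ i.+1)
    ((gauss_bin q^-1 n i + q^-1 ^+ i.+1 * gauss_bin q^-1 n i.+1)
       *: (g ^+ i.+1 * x ^+ (n - i)))); last first.
  by apply: eq_bigr => i _; rewrite /bump /= add1n subSS.
under [RHS]eq_bigr do rewrite scalerDl tensDr.
rewrite big_split; congr (_ + _); rewrite [RHS]big_ord_recr /=.
rewrite gauss_bin_small // mulr0 scale0r tens0r addr0.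
by apply: eq_bigr => i _; rewrite /bump /= add1n subSS.
Qed.

(** * Idempotents of semisimple subalgebras *)

Section LinearAlgebra.
Variables (k : fieldType) (H : falgType k).
Implicit Types (U V : {vspace H}).

Lemma memv_prod_sum U V v : v \in (U * V)%VS ->
  exists n (a b : 'I_n -> H),
    [/\ forall i, a i \in U, forall i, b i \in V & v = \sum_i a i * b i].
Proof.
move=> vUV; exists (\dim V).
have sUV : (U * V <= \sum_(i < \dim V) U * <[(vbasis V)`_i]>)%VS.
  apply/prodvP => a b aU bV.
  rewrite (coord_vbasis bV) mulr_sumr memv_suml // => i _.
  rewrite -scalerAr scalerAl; apply: (subvP (sumv_sup i _ (subvv _))) => //.
  by rewrite memv_mul ?memv_line // memvZ.
have /memv_sumP[c cP ->] := subvP sUV _ vUV.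
have ca (i : 'I_(\dim V)) : exists2 a, a \in U & c i = a * (vbasis V)`_i.
  exact/memv_cosetP/cP.
have [a aU cE] := fin_all_exists2 ca.
exists a, (fun i => (vbasis V)`_i); split=> // [i|]; last exact: eq_bigr.
by apply/vbasis_mem/mem_nth; rewrite size_tuple.
Qed.

End LinearAlgebra.

(** The field is algebraically closed, so the characteristic
    polynomial of right multiplication by [s] on [U] has a root. *)
Lemma stable_eigenvector (k : closedFieldType) (H : falgType k)
    (U : {vspace H}) (s : H) :
    U != 0%VS -> (forall u, u \in U -> u * s \in U) ->
  exists c v, [/\ v \in U, v != 0 & v * s = c *: v].
Proof.
move=> U0 Us; have dU : (0 < \dim U)%N by rewrite lt0n dimv_eq0.
pose X := vbasis U; pose M := \matrix_(i < \dim U, j < \dim U) coord X j (X`_i * s).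
have [c /eigenvalueP[z zM z0]] : exists c, eigenvalue M c.
  have /closed_rootP[c cM] : size (char_poly M) != 1%N.
    by rewrite size_char_poly eqSS -lt0n.
  by exists c; rewrite eigenvalue_root_char.
have freeX : free X := basis_free (vbasisP U).
exists c, (\sum_i z 0 i *: X`_i); split.
- rewrite memv_suml // => i _.
  by rewrite memvZ // vbasis_mem // mem_nth ?size_tuple.
- apply: contraNneq z0 => z0; apply/eqP/rowP => i; rewrite mxE.
  by rewrite -(coord_sum_free (fun i => z 0 i) i freeX) z0 linear0.
rewrite mulr_suml scaler_sumr.
transitivity (\sum_i \sum_j (z 0 i * M i j) *: X`_j).
  apply: eq_bigr => i _; rewrite -scalerAl.
  have XsU : X`_i * s \in U by rewrite Us // vbasis_mem // mem_nth ?size_tuple.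
  rewrite {1}(coord_vbasis XsU) scaler_sumr.
  by apply: eq_bigr => j _; rewrite scalerA mxE.
rewrite exchange_big; apply: eq_bigr => j _ /=.
have /rowP/(_ j) := zM; rewrite !mxE => zMj.
by rewrite -scaler_suml zMj scalerA.
Qed.

Section SemisimpleSubalgebra.
Variables (k : fieldType) (H : falgType k) (S : {vspace H}).
Hypothesis S1 : 1 \in S.
Hypothesis SM : forall s t, s \in S -> t \in S -> s * t \in S.
Hypothesis S_ss : semisimple_subalgebra S.

(** The component in [U] of the decomposition of 1 along
    a complementary left ideal. *)
Lemma left_ideal_idempotent (U : {vspace H}) :
    (U <= S)%VS -> (S * U <= U)%VS ->
  exists2 f, f \in U & forall u, u \in U -> u * f = u.
Proof.
move=> US SU; have [W [WS SW UW UW0]] := S_ss US SU.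
have /memv_addP[f fU [w wW e1]] : 1 \in (U + W)%VS by rewrite UW.
exists f => // u uU; apply/esym/eqP; rewrite -subr_eq0 -memv0 -UW0 memv_cap.
have uS := subvP US u uU.
apply/andP; split.
  by rewrite rpredB // (subvP SU) // memv_mul.
have -> : u - u * f = u * w by rewrite -{1}[u]mulr1 e1 mulrDr addrC addKr.
by rewrite (subvP SW) // memv_mul.
Qed.

(** Let [c] be a right unit of [I] from
    [left_ideal_idempotent] and [w = u - c u].  Then [w S w = 0], because [w s]
    lies in [I], where [c] is a right unit; so the left ideal [S w] has square
    zero, and it vanishes as it is generated by an idempotent. *)
Lemma two_sided_ideal_unit (I : {vspace H}) :
    (I <= S)%VS -> (S * I <= I)%VS -> (I * S <= I)%VS ->
  exists2 c, c \in I & (forall u, u \in I -> c * u = u /\ u * c = u).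
Proof.
move=> IS SI IrS; have [c cI Ic] := left_ideal_idempotent IS SI.
exists c => // u uI; split; last exact: Ic.
have IuS v s : v \in I -> s \in S -> v * s \in I.
  by move=> vI sS; rewrite (subvP IrS) // memv_mul.
pose w := u - c * u.
have wI : w \in I by rewrite rpredB // IuS // (subvP IS).
(* w s c = w s since w s lies in I *)
have wsw s : s \in S -> w * s * w = 0.
  move=> sS; rewrite /w mulrBr mulrA Ic ?subrr //.
  exact: IuS.
have [||l /memv_cosetP[s sS lE] lP] := @left_ideal_idempotent (S * <[w]>)%VS.
- apply/prodvP => s z sS /vlineP[d ->].
  by rewrite SM // memvZ // (subvP IS).
- by rewrite prodvA; apply/prodvSl/prodvP.
have w_in : w \in (S * <[w]>)%VS by rewrite -{1}[w]mul1r memv_mul ?memv_line.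
have := lP _ w_in; rewrite lE mulrA wsw // => w0.
by apply/esym/eqP; rewrite -subr_eq0 -/w -w0 eqxx.
Qed.

Lemma two_sided_ideal_unit_central (I : {vspace H}) c :
    (S * I <= I)%VS -> (I * S <= I)%VS -> c \in I ->
    (forall u, u \in I -> c * u = u /\ u * c = u) ->
  forall s, s \in S -> c * s = s * c.
Proof.
move=> SI IS cI cP s sS.
have [csI scI] : c * s \in I /\ s * c \in I.
  by split; [rewrite (subvP IS) | rewrite (subvP SI)]; rewrite // memv_mul.
by rewrite -(cP _ csI).2 -[RHS](cP _ scI).1 mulrA.
Qed.

End SemisimpleSubalgebra.

Lemma proper_dimv (k : fieldType) (V : vectType k) (K U : {vspace V}) u :
  (K <= U)%VS -> u \in U -> u \notin K -> (\dim K < \dim U)%N.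
Proof.
move=> KU uU uK; rewrite ltnNge; apply: contraNN uK => dUK.
by have/eqP-> : K == U by rewrite eqEdim KU.
Qed.

Section PrimitiveIdempotent.
Variables (k : closedFieldType) (H : falgType k) (S : {vspace H}).
Hypothesis S1 : 1 \in S.
Hypothesis SM : forall s t, s \in S -> t \in S -> s * t \in S.
Hypothesis S_ss : semisimple_subalgebra S.

(** Descend on the dimension of a left ideal [U = S f] with
    [U e <> 0].  If some [f s f] is not a multiple of [f], subtract an
    eigenvalue to get a nonzero [z] in [f S f]; its annihilator [K] in [U] is
    a nonzero proper left ideal.  Since [U] is the direct sum of [K] and of a
    complementary left ideal, one of these two smaller ideals is not killed by
    [e]. *)
Lemma split_idempotent (e : H) : e != 0 ->
  exists f, [/\ f \in S, f * f = f, f * e != 0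
              & forall s, s \in S -> exists c, f * s * f = c *: f].
Proof.
move=> e0.
have ann_ideal (U : {vspace H}) z : (U <= S)%VS -> (S * U <= U)%VS ->
    (S * (U :&: lker (amulr z)) <= U :&: lker (amulr z))%VS.
  move=> US SU; apply/prodvP => s u sS; rewrite !memv_cap => /andP[uU].
  rewrite !memv_ker !lfunE /= => /eqP uz; rewrite -mulrA uz mulr0 eqxx andbT.
  by rewrite (subvP SU) // memv_mul.
suff main n (U : {vspace H}) : (\dim U < n)%N -> (U <= S)%VS -> (S * U <= U)%VS ->
    (exists2 u, u \in U & u * e != 0) ->
  exists f, [/\ f \in S, f * f = f, f * e != 0
              & forall s, s \in S -> exists c, f * s * f = c *: f].
  apply: (main _ S (leqnn _)) => //; first exact/prodvP.
  by exists 1; rewrite ?mul1r.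
elim: n U => // n IHn U dU US SU [u uU ue].
have [f fU Uf] := left_ideal_idempotent S1 S_ss US SU.
have fS := subvP US f fU.
have fe : f * e != 0.
  by apply: contraNneq ue => fe; rewrite -(Uf u uU) -mulrA fe mulr0.
have ff := Uf f fU.
have f0 : f != 0 by apply: contraNneq fe => ->; rewrite mul0r.
have [/subvP fSf|] := boolP ((amulr f \o amull f) @: S <= <[f]>)%VS.
  exists f; split=> // s sS; apply/vlineP.
  have /fSf := memv_img (amulr f \o amull f)%VF sS.
  by rewrite comp_lfunE !lfunE.
case/subvPn => _ /memv_imgP[s sS ->]; rewrite comp_lfunE !lfunE /= => fsf.
have fsfU : f * s * f \in U by rewrite (subvP SU) // memv_mul ?SM.
have U0 : U != 0%VS.
  by apply: contraNneq f0 => U0; rewrite U0 memv0 in fU.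
have [|c [v [vU v0 vc]]] := @stable_eigenvector k H U (f * s * f) U0.
  by move=> t tU; rewrite (subvP SU) // memv_mul // (subvP US).
(* z is not zero, but it kills the eigenvector v *)
pose z := f * s * f - c *: f.
have z0 : z != 0.
  apply: contraNneq fsf => /eqP; rewrite subr_eq0 => /eqP->.
  by rewrite memvZ ?memv_line.
have fz : f * z = z by rewrite /z mulrBr -scalerAr ff !mulrA ff.
pose K := (U :&: lker (amulr z))%VS.
have KP t : (t \in K) = (t \in U) && (t * z == 0).
  by rewrite memv_cap memv_ker lfunE.
have KU : (K <= U)%VS := capvSl _ _.
have KS := subv_trans KU US.
have dK : (\dim K < n)%N.
  rewrite -ltnS (leq_trans _ dU) // ltnS; apply: (proper_dimv KU fU).
  by rewrite KP fz (negbTE z0) andbF.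
have vK : v \in K by rewrite KP vU /z mulrBr vc -scalerAr (Uf v vU) subrr eqxx.
have SK : (S * K <= K)%VS := ann_ideal U z US SU.
have [Ke|/subvPn[w wK]] := boolP (K <= lker (amulr e))%VS; last first.
  rewrite memv_ker lfunE /= => we.
  by apply: (IHn K) => //; exists w.
have [g gK Kg] := left_ideal_idempotent S1 S_ss KS SK.
have gU := subvP KU g gK.
have g0 : g != 0 by apply: contraNneq v0 => g0; rewrite -(Kg v vK) g0 mulr0.
have Ke0 w : w \in K -> w * e = 0.
  by move=> /(subvP Ke); rewrite memv_ker lfunE => /eqP.
pose K' := (U :&: lker (amulr g))%VS.
have K'P w : (w \in K') = (w \in U) && (w * g == 0).
  by rewrite memv_cap memv_ker lfunE.
have K'U : (K' <= U)%VS := capvSl _ _.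
apply: (IHn K'); [|exact: subv_trans US|exact: ann_ideal|].
  rewrite -ltnS (leq_trans _ dU) // ltnS; apply: (proper_dimv K'U gU).
  by rewrite K'P (Kg g gK) (negbTE g0) andbF.
have ugK : u * g \in K by rewrite (subvP SK) // memv_mul // (subvP US).
exists (u - u * g); last by rewrite mulrBl (Ke0 _ ugK) subr0.
by rewrite K'P rpredB ?(subvP KU _ ugK) // mulrBl -mulrA (Kg g gK) subrr eqxx.
Qed.

End PrimitiveIdempotent.

(** * The matrix algebra and the Taft algebra as corners *)

Lemma family_coordinates (k : fieldType) (V : vectType k) (J : finType)
    (b : J -> V) :
    (fullv <= <<codom b>>)%VS -> (#|J| <= \dim {:V})%N ->
  exists c : J -> V -> k,
    [/\ forall j, scalar (c j), forall j j', c j (b j') = (j == j')%:R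
      & forall v, v = \sum_j c j v *: b j].
Proof.
move=> b_span cardJ; pose X := [tuple of codom b].
have bX : basis_of fullv X by rewrite basisEdim b_span size_tuple.
have Xnth j : X`_(enum_rank j) = b j.
  by rewrite nth_codom enum_rankK.
exists (fun j v => coord X (enum_rank j) v); split=> [j z u v|j j'|v].
- by rewrite linearP.
- by rewrite -Xnth coord_free ?(basis_free bX) // (inj_eq enum_rank_inj) eq_sym.
rewrite {1}(coord_basis bX (memvf v)) (reindex_onto enum_rank enum_val) => [|i _].
  by apply: eq_big => [j|j _]; rewrite ?enum_rankK ?eqxx // Xnth.
by rewrite enum_valK.
Qed.

Section RootsOfUnity.
Variables (k : fieldType) (N : nat) (q : k).
Hypothesis qN : N.-primitive_root q.

Lemma prim_root_neq0 : q != 0.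
Proof.
apply: contra_eq_neq (prim_expr_order qN) => ->.
by rewrite expr0n gtn_eqF ?(prim_order_gt0 qN) // eq_sym oner_neq0.
Qed.

Lemma prim_root_inv : N.-primitive_root q^-1.
Proof.
have := exp_prim_root qN N.-1; case: N qN => [/prim_order_gt0 //|n qn] /=.
rewrite (eqP (coprimenS n)) divn1.
suff -> : q ^+ n = q^-1 by [].
apply: (mulIf prim_root_neq0).
by rewrite mulVf ?prim_root_neq0 // -exprSr prim_expr_order.
Qed.

Lemma sum_prim_root_expr d :
  \sum_(t < N) q ^+ (d * t) = (if (N %| d)%N then N%:R else 0).
Proof.
under eq_bigr do rewrite exprM.
rewrite (prim_order_dvd qN); have [->|qd] := eqVneq.
  under eq_bigr do rewrite expr1n.
  by rewrite sumr_const card_ord.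
have /eqP := subrX1 (q ^+ d) N.
rewrite -exprM mulnC exprM (prim_expr_order qN) expr1n subrr eq_sym mulf_eq0.
by rewrite subr_eq0 (negbTE qd) => /eqP.
Qed.

End RootsOfUnity.

Section Taft.
Variables (k : fieldType) (T : algType k) (N : nat) (q : k) (g y : T).
Hypothesis qN : N.-primitive_root q.
Hypothesis gN : g ^+ N = 1.
Hypothesis gy : g * y = q *: (y * g).

(** The projection onto the eigenspace of [g] for the eigenvalue
    [q^i]. *)
Definition eigen_idem (i : nat) : T :=
  N%:R^-1 *: \sum_(t < N) q^-1 ^+ (i * t) *: g ^+ t.

Lemma eigen_idem_per i : eigen_idem (i + N) = eigen_idem i.
Proof.
congr (_ *: _); apply: eq_bigr => t _.
rewrite mulnDl exprD [X in _ * X]exprM [q^-1 ^+ N]exprVn (prim_expr_order qN).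
by rewrite invr1 expr1n mulr1.
Qed.

Lemma eigen_idem_eigen i : g * eigen_idem i = q ^+ i *: eigen_idem i.
Proof.
rewrite /eigen_idem -scalerAr scalerA [q ^+ i * _]mulrC -scalerA.
congr (_ *: _); case: N qN gN => [/prim_order_gt0//|n qn gn].
rewrite mulr_sumr scaler_sumr big_ord_recr [RHS]big_ord_recl addrC /=.
have q0 := prim_root_neq0 qn.
congr (_ + _); last first.
  rewrite -scalerAr -exprS gn muln0 !expr0 scale1r; congr (_ *: _).
  apply: (mulIf (expf_neq0 (i * n) q0)); rewrite exprVn mulVf ?expf_neq0 //.
  by rewrite -exprD -mulnS mulnC exprM (prim_expr_order qn) expr1n.
apply: eq_bigr => t _; rewrite -scalerAr -exprS scalerA; congr (_ *: _).
rewrite /bump /= add1n mulnS exprD mulrA [q^-1 ^+ i]exprVn.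
by rewrite divff ?expf_neq0 // mul1r.
Qed.

Lemma eigen_idem_orth i j : (i < N)%N -> (j < N)%N ->
  eigen_idem i * eigen_idem j = (i == j)%:R *: eigen_idem i.
Proof.
move=> iN jN; have gE t : g ^+ t * eigen_idem j = q ^+ (j * t) *: eigen_idem j.
  elim: t => [|t IHt]; first by rewrite mul1r muln0 scale1r.
  by rewrite exprSr -mulrA eigen_idem_eigen -scalerAr IHt scalerA mulnS exprD.
have q0 := prim_root_neq0 qN.
rewrite {1}/eigen_idem -scalerAl mulr_suml.
transitivity (N%:R^-1 *: ((\sum_(t < N) q ^+ ((j + N - i) * t)) *: eigen_idem j)).
  congr (_ *: _); rewrite scaler_suml; apply: eq_bigr => t _.
  rewrite -scalerAl gE scalerA; congr (_ *: _).
  apply: (mulfI (expf_neq0 (i * t) q0)); rewrite exprVn mulrA divff ?expf_neq0 //.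
  rewrite mul1r -exprD -mulnDl subnKC; last by lia.
  by rewrite mulnDl exprD [X in _ * X]exprM (prim_expr_order qN) expr1n mulr1.
rewrite sum_prim_root_expr //.
have -> : (N %| j + N - i)%N = (i == j).
  apply/idP/eqP => [/dvdnP[d dE]|->]; last by rewrite addKn.
  by case: d dE => [|[|d]] dE; nia.
case: eqP => [->|_]; last by rewrite !scale0r scaler0.
by rewrite scalerA mulVf ?scale1r // (prim_root_natf_neq0 qN).
Qed.

Lemma eigen_idem_shift i : y * eigen_idem i = eigen_idem i.+1 * y.
Proof.
rewrite -scalerAr -scalerAl; congr (_ *: _).
rewrite mulr_sumr mulr_suml; apply: eq_bigr => t _.
have q0 := prim_root_neq0 qN.
rewrite -scalerAr -scalerAl (scalar_expr_comm t gy) scalerA mulSn addnC exprD.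
by rewrite [q^-1 ^+ t]exprVn mulfVK ?expf_neq0.
Qed.

Lemma eigen_idem_sum : \sum_(i < N) eigen_idem i = 1.
Proof.
rewrite -scaler_sumr exchange_big /=.
have q0 := prim_root_neq0 qN; have N_gt0 := prim_order_gt0 qN.
rewrite (bigD1 (Ordinal N_gt0)) //= [X in _ + X]big1 ?addr0 => [|t t0].
  rewrite -scaler_suml; under eq_bigr do rewrite muln0.
  by rewrite sumr_const card_ord scalerA mulVf ?scale1r // (prim_root_natf_neq0 qN).
rewrite -scaler_suml; under eq_bigr do rewrite mulnC.
rewrite sum_prim_root_expr; last exact: prim_root_inv.
have t_gt0 : (0 < t)%N.
  by rewrite lt0n; apply: contraNneq t0 => t0; apply/eqP/val_inj.
by rewrite ifF ?scale0r // gtnNdvd.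
Qed.

End Taft.

Lemma cyc_dist_succ N i j : (i < N)%N -> (j < N)%N ->
  cyc_dist N (i.+1 %% N) j = ((cyc_dist N i j).+1 %% N)%N.
Proof.
move=> iN jN; rewrite /cyc_dist -addn1 -[in RHS]addn1 modnDml.
have [iN1|Ni] := ltnP (i + 1) N.
  by rewrite (modn_small iN1); congr (_ %% _)%N; lia.
have -> : (i + 1 = N)%N by lia.
rewrite modnn add0n; have -> : (i + N - j + 1 = (N - j) + N)%N by lia.
by rewrite modnDr.
Qed.

(** Orthogonal idempotents [f 0, ..., f (N-1)] permuted cyclically by
    [y].  They are indexed by all natural numbers, with period [N], so that [f_{i+1}]
    makes sense without reduction modulo [N]. *)
Record cyclic_system (k : fieldType) (A : algType k) (N : nat) (f : nat -> A)
    (y : A) (beta : k) : Prop := CyclicSystem {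
  cyc_gt0 : (0 < N)%N;
  cyc_per : forall i, f (i + N) = f i;
  cyc_orth : forall i j, (i < N)%N -> (j < N)%N ->
    f i * f j = (i == j)%:R *: f i;
  cyc_shift : forall i, y * f i = f i.+1 * y;
  cyc_expN : forall i, f i * y ^+ N = beta *: f i
}.

(** The cyclic units form a basis of the corner cut out by the sum
    of the [f i], and this sum generates [A] as a two-sided ideal. *)
Record full_corner (k : fieldType) (A : algType k) (N : nat) (f : nat -> A)
    (y : A) : Prop := FullCorner {
  corner_free : forall x : 'I_N -> 'I_N -> k,
    \sum_i \sum_j x i j *: cyc_unit N f y i j = 0 -> forall i j, x i j = 0;
  corner_span : forall a, exists x : 'I_N -> 'I_N -> k,
    (\sum_(i < N) f i) * a * (\sum_(i < N) f i)
    = \sum_i \sum_j x i j *: cyc_unit N f y i j;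
  corner_full : exists (J : finType) (u v : J -> A),
    \sum_l u l * (\sum_(i < N) f i) * v l = 1
}.

Section CornerMorita.
Variables (k : fieldType) (A : algType k) (N : nat) (f : nat -> A) (y : A).
Variable beta : k.
Hypothesis sys : cyclic_system N f y beta.
Hypothesis corner : full_corner N f y.

Lemma corner_morita (T : algType k) (t : 'I_N -> 'I_N -> T)
    (ct : 'I_N -> 'I_N -> T -> k) :
    (forall i j i' j', t i j * t i' j'
       = (if j == i' then cyc_coef N beta i j j' else 0) *: t i j') ->
    (forall i j, scalar (ct i j)) ->
    (forall i j i' j', ct i j (t i' j') = ((i == i') && (j == j'))%:R) ->
    (forall s, s = \sum_i \sum_j ct i j s *: t i j) ->
    \sum_i t i i = 1 ->
  morita_equivalent A T.
Proof.
move=> tM ct_lin ct_t tE t1.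
have [N_gt0 per orth shift expN] := sys.
have [cfree cspan [J [u [v uv1]]]] := corner.
have diagE : \sum_(i < N) cyc_unit N f y i i = \sum_(i < N) f i.
  by apply: eq_bigr => i _; apply: cyc_unitii.
apply: (morita_of_matrix_families (b := fun i j : 'I_N => cyc_unit N f y i j)
          (u := u) (v := v) _ tM ct_lin ct_t tE t1) => //.
- by move=> i j i' j'; apply: (cyc_unitM N_gt0 per orth shift expN).
- by move=> a; rewrite diagE.
by rewrite diagE.
Qed.

End CornerMorita.

(** For [beta = 1] all structure constants are 1, and the
    cyclic units multiply like the matrix units. *)
Lemma corner_morita_matrix (k : fieldType) (A : algType k) N f (y : A) :
    cyclic_system N f y 1 -> full_corner N f y ->
  morita_equivalent A 'M[k]_N.-1.+1.
Proof.
case: N => [[] //|N] sys corner.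
apply: (corner_morita sys corner (t := fun i j => delta_mx i j)
          (ct := fun i j (M : 'M_N.+1) => M i j)).
- move=> i j i' j'; rewrite [LHS]mul_delta_mx_cond /cyc_coef if_same.
  by case: eqP; rewrite ?scale1r ?scale0r.
- by move=> i j z M M'; rewrite !mxE.
- by move=> i j i' j'; rewrite mxE.
- by move=> M; apply: matrix_sum_delta.
by rewrite -mx1_sum_delta.
Qed.

(** The eigenprojections of [g] and the element [y] form a
    cyclic system with [beta = 0].  The span of its units contains 1 and is
    stable under [g] and [y], hence is all of [T]; as there are [N^2] of them
    they form a basis. *)
Lemma corner_morita_taft (k : fieldType) (A : algType k) N f (y : A) (q : k)
    (T : falgType k) :
    cyclic_system N f y 0 -> full_corner N f y -> is_taft N q T ->
  morita_equivalent A T.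
Proof.
move=> sys corner [qN [g [z [gN zN gz agen dimT]]]].
have N_gt0 := prim_order_gt0 qN.
pose E := eigen_idem N q g.
have E_eigen i : g * E i = q ^+ i *: E i := eigen_idem_eigen qN gN i.
have Tsys : cyclic_system N E z 0.
  split=> // [i|i j iN jN|i|i]; first exact: eigen_idem_per.
  - exact: eigen_idem_orth.
  - exact: eigen_idem_shift.
  by rewrite zN mulr0 scale0r.
have [_ Eper Eorth Eshift EexpN] := Tsys.
pose t (ij : 'I_N * 'I_N) := cyc_unit N E z ij.1 ij.2.
have tmem i j : (i < N)%N -> (j < N)%N -> cyc_unit N E z i j \in <<codom t>>%VS.
  by move=> iN jN; apply/memv_span/(codom_f t (Ordinal iN, Ordinal jN)).
have sumE : \sum_(i < N) E i = 1 by apply: eigen_idem_sum.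
have tspan : (fullv <= <<codom t>>)%VS.
  rewrite -agen; apply: agenv_sub_modl.
    rewrite -memvE -sumE; apply: memv_suml => i _.
    by rewrite -(@cyc_unitii _ _ _ _ z _ (ltn_ord i)) tmem.
  apply/prodvP => a b aU /coord_span-> /=; rewrite mulr_sumr memv_suml // => m _.
  rewrite -scalerAr memvZ //.
  have /codomP[[i j] ->] : (codom t)`_m \in codom t.
    by rewrite mem_nth ?size_codom ?ltn_ord.
  have {a aU} [c [d ->]] : exists c d, a = c *: g + d *: z.
    move: aU; rewrite span_cons span_seq1 => /memv_addP[_ /vlineP[c ->]].
    by case=> _ /vlineP[d ->] ->; exists c, d.
  rewrite -[t (i, j)]/(cyc_unit N E z i j) mulrDl -!scalerAl /cyc_unit !mulrA.
  rewrite E_eigen Eshift.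
  rewrite -scalerAl -mulrA -exprS rpredD ?memvZ //; first exact: tmem.
  have dN : (cyc_dist N i j < N)%N by rewrite ltn_mod.
  have [dN1|] := ltnP (cyc_dist N i j).+1 N; last first.
    move=> Nd; have -> : (cyc_dist N i j).+1 = N by lia.
    by rewrite zN mulr0 mem0v.
  rewrite -(f_mod Eper) -(modn_small dN1) -cyc_dist_succ //.
  by rewrite -/(cyc_unit _ _ _ _ _) tmem // ltn_mod.
have [|c [clin ct tE]] := family_coordinates tspan.
  by rewrite card_prod card_ord dimT.
apply: (corner_morita sys corner (t := fun i j => t (i, j))
          (ct := fun i j => c (i, j))).
- by move=> i j i' j'; apply: (cyc_unitM N_gt0 Eper Eorth Eshift EexpN).
- by move=> i j; apply: clin.
- by move=> i j i' j'; rewrite ct.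
- by move=> s; rewrite pair_bigA {1}[s]tE; apply: eq_bigr => -[i j] _.
rewrite -sumE; apply: eq_bigr => i _; exact: cyc_unitii.
Qed.

(** * Central idempotents and blocks *)

Lemma aspace_ideal_central (k : fieldType) (H : falgType k) (B : {aspace H}) h :
  ideal2 B -> algid B * h = h * algid B.
Proof.
move=> [HB BH]; have eB := memv_algid B.
have ehB : algid B * h \in B by rewrite (subvP BH) // memv_mul ?memvf.
have heB : h * algid B \in B by rewrite (subvP HB) // memv_mul ?memvf.
by rewrite -(algidr ehB) -[RHS](algidl heB) mulrA.
Qed.

(** The two ideals [z B] and [(1 - z) B] decompose [B];
    the first contains [u], so the second is zero. *)
Lemma block_central_idempotent (k : fieldType) (H : falgType k)
    (B : {aspace H}) (z u : H) :
    block B -> (forall h, z * h = h * z) -> z * z = z ->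
    u \in B -> u != 0 -> z * u = u ->
  z * algid B = algid B.
Proof.
move=> [[[HB BH] _] [_ B_indec]] zC zz uB u0 zu.
have HBm h b : b \in B -> h * b \in B.
  by move=> bB; rewrite (subvP HB) // memv_mul ?memvf.
have BHm h b : b \in B -> b * h \in B.
  by move=> bB; rewrite (subvP BH) // memv_mul ?memvf.
have idealP c : (forall h, c * h = h * c) -> ideal2 (B :&: lker (amull c)).
  move=> cC; split; apply/prodvP => v w; rewrite !memv_cap !memv_ker !lfunE /=.
    move=> _ /andP[wB /eqP cw]; rewrite HBm //= mulrA cC -mulrA cw mulr0.
    exact: eqxx.
  move=> /andP[vB /eqP cv] _; rewrite BHm //= mulrA cv mul0r.
  exact: eqxx.
have z'C h : (1 - z) * h = h * (1 - z) by rewrite mulrBl mulrBr zC mulr1 mul1r.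
have [| |J0|K0] := B_indec _ _ (idealP _ z'C) (idealP _ zC).
- apply/eqP; rewrite eqEsubv subv_add !capvSl /=; apply/subvP => b bB.
  rewrite -[b](subrK (z * b)) addrC memv_add // !memv_cap !memv_ker !lfunE /=.
    by rewrite HBm //= mulrA mulrBl mul1r zz subrr mul0r eqxx.
  by rewrite rpredB ?HBm //= mulrBr mulrA zz subrr eqxx.
- apply/eqP; rewrite -subv0; apply/subvP => b.
  rewrite !memv_cap !memv_ker !lfunE /= memv0 mulrBl mul1r subr_eq0.
  by case/andP => /andP[_ /eqP zb] /andP[_ /eqP zb0]; rewrite zb zb0.
- suff : u \in (B :&: lker (amull (1 - z)))%VS by rewrite J0 memv0 (negbTE u0).
  by rewrite memv_cap uB memv_ker lfunE /= mulrBl mul1r zu subrr eqxx.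
have : algid B - z * algid B \in (B :&: lker (amull z))%VS.
  rewrite memv_cap memv_ker lfunE /= rpredB ?HBm ?memv_algid //=.
  by rewrite mulrBr mulrA zz subrr eqxx.
by rewrite K0 memv0 subr_eq0 => /eqP.
Qed.

(** * Skew extensions of a semisimple algebra *)

(** The algebra [H] is a quotient of the skew polynomial ring
    [S[x; tau]]: freeness over [S] on [1, ..., x^(N-1)] is split into
    [skew_span] and the weak form [skew_free], which suffices because the
    idempotents of the cyclic system separate the powers of [x]. *)
Record skew_extension (k : fieldType) (H : falgType k) (S : {vspace H})
    (tau : 'End(H)) (x a : H) (N : nat) (q alpha : k) : Prop := SkewExtension {
  skew1 : 1 \in S;
  skewM : forall s t, s \in S -> t \in S -> s * t \in S;
  skew_tau : forall s, s \in S -> tau s \in S;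
  skew_tauM : forall s t, s \in S -> t \in S -> tau (s * t) = tau s * tau t;
  skew_tauN : forall s, s \in S -> iter N tau s = s;
  skew_comm : forall s, s \in S -> x * s = tau s * x;
  skew_a : a \in S;
  skew_aC : forall s, s \in S -> a * s = s * a;
  skew_a_unit : exists b, b * a = 1;
  skew_tau_a : tau a = q^-1 *: a;
  skew_root : N.-primitive_root q;
  skew_gt1 : (1 < N)%N;
  skew_expN : x ^+ N = alpha *: (a ^+ N - 1);
  skew_span : forall h, exists2 s : nat -> H,
    forall i, s i \in S & h = \sum_(i < N) s i * x ^+ i;
  skew_free : forall s i, s \in S -> (i < N)%N -> s * x ^+ i = 0 -> s = 0
}.

Section SkewExtensionBlocks.
Variables (k : closedFieldType) (H : falgType k) (S : {vspace H}).
Variables (tau : 'End(H)) (x a : H) (N : nat) (q alpha : k).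
Hypothesis ext : skew_extension S tau x a N q alpha.
Hypothesis S_ss : semisimple_subalgebra S.

Let S1 := skew1 ext.
Let SM := skewM ext.
Let N_gt1 := skew_gt1 ext.
Let N_gt0 : (0 < N)%N := ltnW N_gt1.
Let q_neq0 : q != 0 := prim_root_neq0 (skew_root ext).
Let qN : q ^+ N = 1 := prim_expr_order (skew_root ext).

Lemma iter_tau_mem i s : s \in S -> iter i tau s \in S.
Proof. by move=> sS; elim: i => //= i; apply: skew_tau ext _. Qed.

Lemma iter_tauM i s t : s \in S -> t \in S ->
  iter i tau (s * t) = iter i tau s * iter i tau t.
Proof.
move=> sS tS; elim: i => //= i ->.
by rewrite (skew_tauM ext) ?iter_tau_mem.
Qed.

Lemma iter_tauZ i z s : iter i tau (z *: s) = z *: iter i tau s.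
Proof. by elim: i => //= i ->; rewrite linearZ. Qed.

Lemma iter_tau_sum i n (s : 'I_n -> H) :
  iter i tau (\sum_l s l) = \sum_l iter i tau (s l).
Proof. by elim: i => //= i ->; rewrite linear_sum. Qed.

Lemma iter_tauMN i s : s \in S -> iter (i * N) tau s = s.
Proof.
move=> sS; elim: i => // i IHi; rewrite mulSn iterD IHi; exact: skew_tauN ext _ _.
Qed.

Lemma iter_tau_surj i s : s \in S ->
  exists2 t, t \in S & iter i tau t = s.
Proof.
move=> sS; exists (iter (i * N.-1) tau s); first exact: iter_tau_mem.
by rewrite -iterD -mulnS prednK // iter_tauMN.
Qed.

Lemma iter_tau_a i : iter i tau a = q^-1 ^+ i *: a.
Proof.
elim: i => [|i IHi]; first by rewrite scale1r.
by rewrite /= IHi linearZ /= (skew_tau_a ext) scalerA -exprSr.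
Qed.

Lemma skew_commX m s : s \in S -> x ^+ m * s = iter m tau s * x ^+ m.
Proof.
move=> sS; elim: m => [|m IHm]; first by rewrite mul1r mulr1.
by rewrite exprS -mulrA IHm mulrA (skew_comm ext) ?iter_tau_mem // -mulrA.
Qed.

(** Since [a] commutes with [u], it acts on [u v] both by [lam] and
    by [mu]. *)
Lemma eigen_mul0 lam mu u v : u \in S ->
  a * u = lam *: u -> a * v = mu *: v -> lam != mu -> u * v = 0.
Proof.
move=> uS au av lm; apply/eqP.
have /eqP : lam *: (u * v) = mu *: (u * v).
  by rewrite scalerAl -au (skew_aC ext) // -mulrA av scalerAr.
rewrite -subr_eq0 -scalerBl scaler_eq0 subr_eq0 (negbTE lm).
by case/orP => // /eqP.
Qed.

(** Apply [tau^i] and use [tau^i(a) = q^-i a]. *)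
Lemma eigen_tau lam s i : s \in S -> a * s = lam *: s ->
  a * iter i tau s = (lam * q ^+ i) *: iter i tau s.
Proof.
move=> sS as_; have := congr1 (iter i tau) as_.
rewrite iter_tauZ iter_tauM ?(skew_a ext) // iter_tau_a -scalerAl.
move/(congr1 (fun h => q ^+ i *: h)); rewrite !scalerA -exprMn mulfV //.
by rewrite expr1n scale1r mulrC.
Qed.

Lemma eigen_neq lam i j : lam != 0 -> (i < N)%N -> (j < N)%N -> i != j ->
  lam * q ^+ i != lam * q ^+ j.
Proof.
move=> lam0 iN jN; apply: contraNneq => /(mulfI lam0)/eqP.
by rewrite (eq_prim_root_expr (skew_root ext)) !modn_small.
Qed.

Section Idempotent.
Variable f : H.
Hypothesis fS : f \in S.
Hypothesis ff : f * f = f.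
Hypothesis f0 : f != 0.
Hypothesis fSf : forall s, s \in S -> exists c, f * s * f = c *: f.

Let fi i := iter i tau f.

Let fiS i : fi i \in S. Proof. exact: iter_tau_mem. Qed.

(** [a f = f a f], and [lam] is nonzero because [a] is
    invertible. *)
Lemma corner_scalar : exists2 lam, lam != 0 & a * f = lam *: f.
Proof.
have [lam lamE] := fSf (skew_a ext).
have af : a * f = lam *: f by rewrite -lamE -(skew_aC ext) // -mulrA ff.
exists lam => //; apply: contraNneq f0 => lam0.
have [b ba] := skew_a_unit ext.
by rewrite -[f]mul1r -ba -mulrA af lam0 scale0r mulr0.
Qed.

Lemma conj_idem i : fi i * fi i = fi i.
Proof. by rewrite /fi -iter_tauM // ff. Qed.

Lemma conj_neq0 i : fi i != 0.
Proof.
apply: contraNneq f0 => fi0; rewrite -(iter_tauMN i fS) mulnC.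
have -> : (N * i = (N.-1 * i) + i)%N by rewrite -{1}(prednK N_gt0) mulSn addnC.
rewrite iterD -/(fi i) fi0; apply/eqP.
by elim: (_ * i)%N => //= m ->; rewrite linear0.
Qed.

(** [tau^i] maps [S] onto [S], which transports the property of
    [f] to its conjugate. *)
Lemma conj_corner i s : s \in S -> exists c, fi i * s * fi i = c *: fi i.
Proof.
move=> sS; have [t tS <-] := iter_tau_surj i sS.
have [c cE] := fSf tS; exists c.
by rewrite /fi -!iter_tauM ?SM // cE iter_tauZ.
Qed.

Lemma conj_per i : fi (i + N) = fi i.
Proof. by rewrite /fi addnC iterD (skew_tauN ext) // fiS. Qed.

Lemma conj_sandwich0 i j s : (i < N)%N -> (j < N)%N -> i != j -> s \in S ->
  fi i * s * fi j = 0.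
Proof.
move=> iN jN ij sS; have [lam lam0 af] := corner_scalar.
apply: (@eigen_mul0 (lam * q ^+ i) (lam * q ^+ j)); rewrite ?SM //.
- by rewrite mulrA (eigen_tau i fS af) -scalerAl.
- exact: eigen_tau.
exact: eigen_neq.
Qed.

Lemma conj_orth i j : (i < N)%N -> (j < N)%N ->
  fi i * fi j = (i == j)%:R *: fi i.
Proof.
move=> iN jN; case: eqP => [<-|/eqP ij]; first by rewrite conj_idem scale1r.
by rewrite scale0r -[fi i]mulr1 conj_sandwich0.
Qed.

(** Here [b = alpha (lam^N - 1)]: the element [a^N] acts on the
    [i]-th conjugate by [(lam q^i)^N = lam^N], independently of [i]. *)
Lemma conj_expN : exists b, forall i, fi i * x ^+ N = b *: fi i.
Proof.
have [lam lam0 af] := corner_scalar; exists (alpha * (lam ^+ N - 1)) => i.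
have aX m : a ^+ m * fi i = (lam * q ^+ i) ^+ m *: fi i.
  elim: m => [|m IHm]; first by rewrite mul1r scale1r.
  by rewrite exprSr -mulrA (eigen_tau i fS af) -scalerAr IHm scalerA exprS.
have aXC m s : s \in S -> a ^+ m * s = s * a ^+ m.
  move=> sS; elim: m => [|m IHm]; first by rewrite mul1r mulr1.
  by rewrite exprS -mulrA IHm mulrA (skew_aC ext) // -mulrA.
rewrite (skew_expN ext) -scalerAr mulrBr -aXC // aX mulr1.
rewrite exprMn -exprM mulnC exprM qN expr1n mulr1.
by rewrite -[X in _ - X]scale1r -scalerBl scalerA.
Qed.

(** Moving the right hand idempotent across the powers of [x]
    turns [f_i s x^m f_j] into [f_i s f_{j+m} x^m], which vanishes except for
    the one exponent [m = cyc_dist i j]. *)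
Lemma conj_corner_unit h i j : (i < N)%N -> (j < N)%N ->
  exists c, fi i * h * fi j = c *: cyc_unit N fi x i j.
Proof.
move=> iN jN; have [s sS ->] := skew_span ext h.
have [c cE] := conj_corner i (sS (cyc_dist N i j)); exists c.
have dN : (cyc_dist N i j < N)%N by rewrite ltn_mod.
rewrite mulr_sumr mulr_suml (bigD1 (Ordinal dN)) //= big1 ?addr0 => [|m mi].
  rewrite -!mulrA skew_commX // -iterD addnC -/(fi (j + _)) -(f_mod conj_per (j + _)).
  have /eqP -> : ((j + cyc_dist N i j) %% N == i)%N.
    by rewrite cyc_dist_shift.
  by rewrite mulrA mulrA cE -scalerAl.
rewrite -!mulrA skew_commX // -iterD addnC -/(fi (j + _)) -(f_mod conj_per (j + _)).
rewrite mulrA mulrA conj_sandwich0 ?mul0r ?ltn_mod // eq_sym.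
apply: contraNneq mi => mE; apply/eqP/val_inj => /=.
have : (j + m = j + cyc_dist N i j %[mod N])%N.
  by rewrite mE; apply/esym/eqP; rewrite cyc_dist_shift.
by move/eqP; rewrite eqn_modDl !modn_small // => /eqP.
Qed.

(** Take the central idempotent [c] of [S] that generates
    the ideal [S f S].  Its conjugates [tau^i(c)], [i < N], are orthogonal since
    [a] acts on them by distinct scalars, and [x] permutes them cyclically; so
    their sum is central in [H]. *)
Lemma conj_central_support : exists z : H,
  [/\ forall h, z * h = h * z, z * z = z,
      forall i, (i < N)%N -> z * fi i = fi i
    & exists n (u v : 'I_N * 'I_n -> H),
        z = \sum_j u j * fi j.1 * v j].
Proof.
pose I := (S * <[f]> * S)%VS.
have S_S : (S * S <= S)%VS by apply/prodvP; apply: SM.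
have SfS : (S * <[f]> <= S)%VS.
  by apply/prodvP => s t sS /vlineP[c ->]; rewrite SM // memvZ.
have IS : (I <= S)%VS by apply: subv_trans (prodvSl _ SfS) S_S.
have SI : (S * I <= I)%VS by rewrite /I !prodvA; do 2!apply: prodvSl.
have IrS : (I * S <= I)%VS by rewrite /I -!prodvA; do 2!apply: prodvSr.
have [e0 e0I e0P] := two_sided_ideal_unit S1 SM S_ss IS SI IrS.
have e0C := two_sided_ideal_unit_central SI IrS e0I e0P.
have e0S := subvP IS e0 e0I.
have fI : f \in I.
  by rewrite -[f]mulr1 -[f]mul1r !memv_mul ?memv_line.
have e0f : e0 * f = f := (e0P f fI).1.
have [n [u [w [uS wS e0E]]]] : exists n (u w : 'I_n -> H),
    [/\ forall l, u l \in S, forall l, w l \in S & e0 = \sum_l u l * f * w l].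
  have [n [b [w [bS wS ->]]]] := memv_prod_sum e0I.
  have bE l : exists2 u, u \in S & b l = u * f by apply/memv_cosetP/bS.
  have [u uS bE'] := fin_all_exists2 bE.
  by exists n, u, w; split=> //; apply: eq_bigr => l _; rewrite bE'.
have [lam lam0 af] := corner_scalar.
have ae0 : a * e0 = lam *: e0.
  rewrite e0E mulr_sumr scaler_sumr; apply: eq_bigr => l _.
  by rewrite !mulrA (skew_aC ext) // -[_ * a * f]mulrA af -scalerAr -!scalerAl.
pose ei i := iter i tau e0.
have eiS i : ei i \in S by apply: iter_tau_mem.
have eiC i s : s \in S -> ei i * s = s * ei i.
  by move=> sS; have [t tS <-] := iter_tau_surj i sS; rewrite -!iter_tauM // e0C.
have ei_idem i : ei i * ei i = ei i by rewrite -iter_tauM // (e0P _ e0I).1.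
have ei0 i j t : (i < N)%N -> (j < N)%N -> i != j -> a * t = (lam * q ^+ j) *: t ->
    ei i * t = 0.
  move=> iN jN ij at_; apply: (eigen_mul0 (eiS i) _ at_).
    exact: eigen_tau ae0.
  exact: eigen_neq.
have sum_ei j t : (j < N)%N -> a * t = (lam * q ^+ j) *: t -> ei j * t = t ->
    (\sum_(i < N) ei i) * t = t.
  move=> jN at_ et; rewrite mulr_suml (bigD1 (Ordinal jN)) //= et big1 ?addr0 //.
  by move=> i ij; apply: (@ei0 i j).
exists (\sum_(i < N) ei i); split.
- move=> h; have [s sS ->] := skew_span ext h; rewrite mulr_sumr mulr_suml.
  apply: eq_bigr => m _.
  (* x permutes the conjugates cyclically, and the last one is the first *)
  have zx : x * (\sum_(i < N) ei i) = (\sum_(i < N) ei i) * x.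
    rewrite mulr_sumr mulr_suml; have eiN : ei N = ei 0 by apply: skew_tauN ext _ _.
    case: N eiN N_gt0 => // n' eiN _.
    rewrite big_ord_recr [RHS]big_ord_recl /= addrC.
    congr (_ + _); first by rewrite (skew_comm ext) // -[tau _]/(ei n'.+1) eiN.
    by apply: eq_bigr => i _; rewrite (skew_comm ext).
  have zxm : (\sum_(i < N) ei i) * x ^+ m = x ^+ m * (\sum_(i < N) ei i).
    exact/commrX/esym.
  rewrite -[RHS]mulrA -zxm !mulrA; congr (_ * _).
  by rewrite mulr_sumr mulr_suml; apply: eq_bigr => i _; apply: eiC.
- rewrite mulr_sumr; apply: eq_bigr => j _; apply: (sum_ei j) => //.
  exact: eigen_tau ae0.
- move=> i iN; apply: (sum_ei i) => //; first exact: eigen_tau.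
  by rewrite -iter_tauM // e0f.
exists n, (fun j : 'I_N * 'I_n => iter j.1 tau (u j.2)),
  (fun j : 'I_N * 'I_n => iter j.1 tau (w j.2)).
rewrite -(pair_bigA _
  (fun (i : 'I_N) l => iter i tau (u l) * fi i * iter i tau (w l))).
apply: eq_bigr => i _; rewrite /ei e0E iter_tau_sum; apply: eq_bigr => l _.
by rewrite !iter_tauM ?SM.
Qed.

End Idempotent.

(** Replacing [x] by [d x] multiplies the scalar [b] by which
    [x^N] acts by [d^N]; a nonzero [b] is cancelled by an [N]-th root of its
    inverse. *)
Lemma normalize_scalar (b : k) :
  exists2 d : k, d != 0 & d ^+ N * b = 0 \/ d ^+ N * b = 1.
Proof.
have [->|b0] := eqVneq b 0.
  by exists 1; [apply: oner_neq0 | left; rewrite mulr0].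
have [d dP] : exists d, root ('X^N - b^-1%:P) d.
  by apply/closed_rootP; rewrite size_XnsubC ?eqSS -?lt0n.
have dN : d ^+ N = b^-1.
  by move: dP; rewrite /root !hornerE subr_eq0 => /eqP.
exists d; last by right; rewrite dN mulVf.
apply: contraNneq b0 => d0; move: dN; rewrite d0 expr0n gtn_eqF //.
by move/esym/eqP; rewrite invr_eq0.
Qed.

(** The unit of the algebra [B] is [e], so [x] is replaced by
    [d x e], where the scalar [d] normalizes the action of [x^N]; the factor [e]
    disappears in products with the [f_i], as [f_i e = f_i]. *)
Lemma skew_extension_block (B : {aspace H}) : block B ->
  exists (f : nat -> subvs_of B) (y : subvs_of B) (b : k),
    [/\ cyclic_system N f y b, full_corner N f y & b = 0 \/ b = 1].
Proof.
move=> blockB; have [[idealB _] _] := blockB.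
pose e := algid B; have eB : e \in B := memv_algid B.
have eC h : e * h = h * e := aspace_ideal_central h idealB.
have ee : e * e = e by apply: algidl.
have [HB BH] := idealB.
have HBm h b : b \in B -> h * b \in B.
  by move=> bB; rewrite (subvP HB) // memv_mul ?memvf.
have [f [fS ff fe fSf]] := split_idempotent S1 SM S_ss (algid_neq0 B).
have f0 : f != 0 by apply: contraNneq fe => ->; rewrite mul0r.
pose fi i := iter i tau f.
have fix0 i m : (m < N)%N -> fi i * x ^+ m != 0.
  move=> mN; apply: contraNneq (conj_neq0 fS f0 i) => fx0; apply/eqP.
  by apply: skew_free ext _ _ _ mN fx0; apply: iter_tau_mem.
have fi_per i : fi (i + N) = fi i by apply: conj_per.
have fi_orth i j : (i < N)%N -> (j < N)%N -> fi i * fi j = (i == j)%:R *: fi i.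
  exact: conj_orth.
have fi_x i : x * fi i = fi i.+1 * x by rewrite (skew_comm ext) ?iter_tau_mem.
(* e acts on each f_i by a scalar, equal to 1 for i = 0 as e is idempotent and
   e f <> 0; moving x across e carries the value from f_i to f_{i+1}. *)
have fie_scal i : (i < N)%N -> exists c, fi i * e = c *: fi i.
  move=> iN; have [c] := conj_corner_unit fS ff f0 fSf e iN iN.
  rewrite -/(fi i) -/fi.
  rewrite (cyc_unitii _ _ iN) -mulrA eC mulrA conj_idem // => ->.
  by exists c.
have fie i : fi i * e = fi i.
  rewrite -(f_mod fi_per); have: (i %% N < N)%N by rewrite ltn_mod.
  elim: (i %% N)%N => [|m IHm] mN.
    have [c cE] := fie_scal 0%N mN; rewrite cE.
    have : c *: fi 0%N = (c * c) *: fi 0%N.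
      by rewrite -scalerA -cE scalerAl -cE -mulrA ee.
    move/eqP; rewrite -subr_eq0 -scalerBl scaler_eq0 (negbTE f0) orbF subr_eq0.
    rewrite -{1}[c]mulr1 => /eqP/mulfI <-; rewrite ?scale1r //.
    by apply: contraNneq fe => c0; rewrite -[f]/(fi 0) cE c0 scale0r.
  have [c cE] := fie_scal _ mN; rewrite cE.
  have /eqP : c *: (fi m.+1 * x ^+ 1) = fi m.+1 * x ^+ 1.
    rewrite expr1 scalerAl -cE -mulrA eC mulrA -fi_x -mulrA IHm // ltnW //.
  rewrite -{2}[fi _ * _]scale1r -subr_eq0 -scalerBl scaler_eq0.
  by rewrite (negbTE (fix0 _ _ N_gt1)) orbF subr_eq0 => /eqP->; rewrite scale1r.
have fiB i : fi i \in B by rewrite -fie HBm.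
have [z [zC zz zfi [n [u [v zE]]]]] := conj_central_support fS ff f0 fSf.
have ze : z * e = e.
  by apply: (block_central_idempotent (u := f) blockB) => //;
     [apply: (fiB 0) | apply: (zfi 0)].
have [b bE] := conj_expN fS ff f0 fSf.
have [d d0 dP] := normalize_scalar b.
have [fB fBE] : exists fB : nat -> subvs_of B, forall i, vsval (fB i) = fi i.
  by exists (fun i => Subvs (fiB i)).
have [y yE] : exists y : subvs_of B, vsval y = d *: (x * e).
  have yB : d *: (x * e) \in B by rewrite memvZ // HBm.
  by exists (Subvs yB).
have vsvalI (b1 b2 : subvs_of B) : vsval b1 = vsval b2 -> b1 = b2 by apply: val_inj.
have vsvalM (b1 b2 : subvs_of B) : vsval (b1 * b2) = vsval b1 * vsval b2 by [].
have vsvalZ c (b1 : subvs_of B) : vsval (c *: b1) = c *: vsval b1 by [].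
have vsval_sum (J : finType) (F : J -> subvs_of B) :
  vsval (\sum_j F j) = \sum_j vsval (F j) by rewrite linear_sum.
have fyE i m : vsval (fB i * y ^+ m) = d ^+ m *: (fi i * x ^+ m).
  elim: m => [|m IHm]; first by rewrite !mulr1 fBE scale1r.
  rewrite !exprSr mulrA vsvalM IHm yE -scalerAl -scalerAr scalerA; congr (_ *: _).
  by rewrite !mulrA -eC !mulrA eC fie.
have cycE i j : vsval (cyc_unit N fB y i j)
    = d ^+ cyc_dist N i j *: cyc_unit N fi x i j by rewrite fyE.
have sys : cyclic_system N fB y (d ^+ N * b).
  split=> // [i|i j iN jN|i|i]; apply: vsvalI.
  - by rewrite !fBE fi_per.
  - by rewrite linearZ vsvalM /= !fBE fi_orth.
  - rewrite !vsvalM !fBE yE -scalerAl -scalerAr -mulrA eC fie fi_x.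
    by rewrite -eC mulrA fie.
  by rewrite fyE linearZ /= fBE bE scalerA.
have sumE : vsval (\sum_(i < N) fB i) = \sum_(i < N) fi i.
  by rewrite vsval_sum; apply: eq_bigr => i _; apply: fBE.
have sum_fi i : (i < N)%N -> fi i * (\sum_(j < N) fi j) = fi i.
  move=> iN; rewrite mulr_sumr (bigD1 (Ordinal iN)) //= fi_orth // eqxx scale1r.
  rewrite big1 ?addr0 // => j ji; rewrite fi_orth //.
  by rewrite eq_sym (negbTE ji : (val j == i) = false) scale0r.
have cyc_pick (i i' j' j : 'I_N) :
    fi i * cyc_unit N fi x i' j' * fi j
    = (if (i' == i) && (j' == j) then 1 else 0) *: cyc_unit N fi x i j.
  rewrite -{1}(cyc_unitii fi x (ltn_ord i)) -(cyc_unitii fi x (ltn_ord j)).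
  rewrite !(cyc_unitM N_gt0 fi_per fi_orth fi_x bE) // -scalerAl.
  rewrite (cyc_unitM N_gt0 fi_per fi_orth fi_x bE) // scalerA.
  rewrite -[i' == i]val_eqE -[j' == j]val_eqE /= [_ i' == _]eq_sym.
  case: eqP => _; last by rewrite mul0r.
  case: eqP => [->|_]; last by rewrite mulr0.
  by rewrite /cyc_coef !cyc_distii // add0n addn0 !ltn_mod N_gt0 mulr1.
exists fB, y, (d ^+ N * b); split=> //; split.
- move=> t tE i j.
  have {}tE : \sum_i \sum_j
      (t i j * d ^+ cyc_dist N i j) *: cyc_unit N fi x i j = 0.
    rewrite -[RHS](congr1 vsval tE) vsval_sum; apply: eq_bigr => i' _.
    rewrite vsval_sum; apply: eq_bigr => j' _.
    by rewrite vsvalZ cycE scalerA.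
  (* sandwiching between f_i and f_j isolates the coefficient at (i, j) *)
  have := congr1 (fun h => fi i * h * fi j) tE.
  rewrite mulr0 mul0r mulr_sumr mulr_suml (bigD1 i) //=.
  rewrite [X in _ + X]big1 ?addr0 => [|i' i'i]; last first.
    rewrite mulr_sumr mulr_suml big1 // => j' _.
    rewrite -!(scalerAl, scalerAr) cyc_pick (negbTE i'i).
    by rewrite scale0r !scaler0.
  rewrite mulr_sumr mulr_suml (bigD1 j) //=.
  rewrite [X in _ + X]big1 ?addr0 => [|j' j'j]; last first.
    rewrite -!(scalerAl, scalerAr) cyc_pick (negbTE j'j) andbF.
    by rewrite scale0r !scaler0.
  rewrite -!(scalerAl, scalerAr) cyc_pick !eqxx scale1r.
  move/eqP; rewrite scaler_eq0 (negbTE (fix0 _ _ _)) ?ltn_mod // orbF.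
  by rewrite mulf_eq0 expf_eq0 (negbTE d0) andbF orbF => /eqP.
- move=> h.
  have hE (ij : 'I_N * 'I_N) : exists c,
      fi ij.1 * vsval h * fi ij.2 = c *: vsval (cyc_unit N fB y ij.1 ij.2).
    have [c cE] := conj_corner_unit fS ff f0 fSf (vsval h)
      (ltn_ord ij.1) (ltn_ord ij.2).
    exists (c / d ^+ cyc_dist N ij.1 ij.2); rewrite cE cycE scalerA divfK //.
    by rewrite expf_neq0.
  have [t tE] := fin_all_exists hE; exists (fun i j => t (i, j)).
  apply: vsvalI; rewrite !vsvalM sumE !mulr_suml vsval_sum.
  apply: eq_bigr => i _; rewrite mulr_sumr vsval_sum; apply: eq_bigr => j _.
  by rewrite (tE (i, j)) vsvalZ.
have uB (j : 'I_N * 'I_n) : e * u j * fi j.1 \in B by rewrite HBm.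
have vB (j : 'I_N * 'I_n) : v j * e \in B by rewrite HBm.
exists ('I_N * 'I_n)%type, (fun j => Subvs (uB j)), (fun j => Subvs (vB j)).
apply: vsvalI; rewrite vsval_sum; transitivity (e * (z * e)); last by rewrite ze ee.
rewrite zE mulr_suml mulr_sumr; apply: eq_bigr => j _.
by rewrite !vsvalM sumE -[e * _ * _ * _]mulrA sum_fi // !mulrA.
Qed.

End SkewExtensionBlocks.

(** * The Hopf algebra of a datum *)

Lemma tens_mul_tensv (k : fieldType) (A : falgType k) (U U' : {vspace A})
    (a b : A) t :
    (forall u, u \in U -> a * u \in U) -> (forall u, u \in U' -> b * u \in U') ->
  t \in tensv U U' -> tens a b * t \in tensv U U'.
Proof.
move=> aU bU' tUU'.
pose X := in_tuple [seq tens u v | u <- vbasis U, v <- vbasis U'].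
rewrite (coord_span (X := X) tUU') mulr_sumr memv_suml // => m _.
rewrite [_ * _](tensor_mulZr _ (tens a b)) memvZ //.
have /allpairsP[[u v] /= [/vbasis_mem uU /vbasis_mem vU' ->]] :
    X`_m \in [seq tens u v | u <- vbasis U, v <- vbasis U'] by rewrite mem_nth.
by rewrite tensor_mul_tens memv_tens ?aU ?bU'.
Qed.

Section RankOne.
Variables (k : fieldType) (gT : finGroupType) (p N : nat) (R : datum k gT).
Variables (H : falgType k) (gr : gT -> H) (x : H)
  (Delta : 'Hom(H, tensor H H)) (eps : 'Hom(H, k^o)) (S : 'End(H)).
Hypothesis pP : p \in [pchar k].
Hypothesis adm : admissible p N R.
Hypothesis HR : is_HR p N R gr x Delta eps S.

Local Notation a := (pt R).
Local Notation q := (chi R (pt R)).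
Local Notation n := (p ^ hgt R * N)%N.

Lemma order_gt1 : (1 < N)%N.
Proof.
have qN := adm_order adm; have := prim_order_gt0 qN.
rewrite leq_eqVlt => /orP[/eqP N1|//]; have := adm_chi_pt adm.
by rewrite -(expr1 (chi R a)) N1 (prim_expr_order qN) eqxx.
Qed.

Lemma degree_gt1 : (1 < n)%N.
Proof.
apply: leq_trans order_gt1 (leq_pmull _ _).
by rewrite expn_gt0 prime_gt0 // (pcharf_prime pP).
Qed.

Lemma HR_x g : x * gr g = (chi R g)^-1 *: (gr g * x).
Proof.
have gV : gr g^-1%g * gr g = 1 by rewrite -(HR_grM HR) mulVg (HR_gr1 HR).
have := congr1 (fun h => h * gr g) (HR_conj HR g).
rewrite -mulrA gV mulr1 -scalerAl => ->.
by rewrite scalerA mulVf ?scale1r // (adm_chi_neq0 adm).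
Qed.

Lemma HR_grX g m : gr (g ^+ m)%g = gr g ^+ m.
Proof.
elim: m => [|m IHm]; first by rewrite expg0 expr0 (HR_gr1 HR).
by rewrite expgS exprS (HR_grM HR) IHm.
Qed.

Lemma gr_a_x : gr a * x = q *: (x * gr a).
Proof. by rewrite HR_x scalerA mulfV ?scale1r // (adm_chi_neq0 adm). Qed.

(** Total coordinate functions, indexed by all exponents [i] and
    zero for [i >= n]. *)
Lemma HR_coordinates : exists c : gT -> nat -> H -> k,
  [/\ forall g i, scalar (c g i),
      forall g i g' i', (i' < n)%N ->
        c g i (gr g' * x ^+ i') = ((g == g') && (i == i'))%:R
    & forall v, v = \sum_g \sum_(i < n) c g i v *: (gr g * x ^+ i)].
Proof.
pose b (j : gT * 'I_n) := gr j.1 * x ^+ j.2.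
have bH := HR_basis HR.
have [||c [c_lin cb cE]] := @family_coordinates k H _ b.
- rewrite -(span_basis bH); apply: sub_span => _ /allpairsP[[g i] /= [_ iP ->]].
  rewrite mem_iota add0n in iP; exact: (codom_f b (g, Ordinal iP)).
- rewrite (size_basis (X := in_tuple _) bH) size_allpairs size_iota -cardE.
  by rewrite card_prod card_ord.
pose c' g i v := if insub i is Some i' then c (g, i') v else 0.
have c'E g (i : 'I_n) v : c' g i v = c (g, i) v by rewrite /c' valK.
exists c'; split=> [g i z u v|g i g' i' i'n|v].
- by rewrite /c'; case: insub => [i'|]; rewrite ?c_lin // mulr0 addr0.
- rewrite /c' -[gr g' * _]/(b (g', Ordinal i'n)).
  case: insubP => [j _ <-|ni]; first by rewrite cb.
  have -> : (i == i') = false by apply: contraNF ni => /eqP->.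
  by rewrite andbF.
rewrite {1}[v]cE pair_bigA; apply: eq_bigr => -[g i] _.
by rewrite -[RHS]/(c' g i v *: b (g, i)) c'E.
Qed.

Section Coordinates.
Variable c : gT -> nat -> H -> k.
Hypothesis c_lin : forall g i, scalar (c g i).
Hypothesis cb : forall g i g' i', (i' < n)%N ->
  c g i (gr g' * x ^+ i') = ((g == g') && (i == i'))%:R.
Hypothesis cE : forall v, v = \sum_g \sum_(i < n) c g i v *: (gr g * x ^+ i).

Definition coef g i (v : H) : k^o := c g i v.
Fact coef_is_linear g i : linear (coef g i).
Proof. exact: c_lin. Qed.
HB.instance Definition _ g i :=
  GRing.isLinear.Build k H k^o _ (coef g i) (coef_is_linear g i).

Definition kG : {vspace H} := <<codom gr>>%VS.

Lemma mem_gr g : gr g \in kG.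
Proof. exact/memv_span/codom_f. Qed.

Lemma kG_ind (P : H -> Prop) :
    (forall s t, P s -> P t -> P (s + t)) -> (forall z g, P (z *: gr g)) ->
  forall s, s \in kG -> P s.
Proof.
move=> PD Pg s /coord_span->; elim/big_ind: _ => // [|m _].
  by rewrite -(scale0r (gr 1%g)).
have /codomP[g ->] // : (codom gr)`_m \in codom gr.
by rewrite mem_nth // size_codom.
Qed.

Lemma coef_kG s g i j : s \in kG -> (j < n)%N ->
  coef g i (s * x ^+ j) = (i == j)%:R * coef g 0 s.
Proof.
move=> sG jn; elim/kG_ind: s / sG => [s t sE tE|z h].
  by rewrite mulrDl !linearD /= sE tE mulrDr.
have n0 : (0 < n)%N := ltnW degree_gt1.
rewrite -scalerAl !linearZ /= -[gr h in RHS]mulr1 -(expr0 x) /coef !cb //.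
by rewrite andbT [RHS]mulrCA -natrM mulnb andbC.
Qed.

Lemma kG_coef s : s \in kG -> s = \sum_g coef g 0 s *: gr g.
Proof.
elim/kG_ind: s / => [s t {1}-> {1}->|z h].
  rewrite -big_split; apply: eq_bigr => g _ /=.
  by rewrite [coef g 0 (_ + _)]linearD scalerDl.
have n0 : (0 < n)%N := ltnW degree_gt1.
have ch g : coef g 0 (z *: gr h) = z * (g == h)%:R.
  by rewrite linearZ -[gr h]mulr1 -(expr0 x) /= /coef cb // andbT.
rewrite (bigD1 h) //= ch eqxx mulr1 big1 ?addr0 // => g gh.
by rewrite ch (negbTE gh) mulr0 scale0r.
Qed.

Lemma HR_Delta_expand g i : (i < n)%N ->
  Delta (gr g * x ^+ i) = \sum_(j < i.+1) tens (gr g * x ^+ j)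
    (gauss_bin q^-1 i j *: (gr g * (gr a ^+ j * x ^+ (i - j)))).
Proof.
move=> iN; rewrite (HR_Delta HR) //.
rewrite (skew_primitive_expr i _ gr_a_x) ?(adm_chi_neq0 adm) //.
by rewrite mulr_sumr; apply: eq_bigr => j _; rewrite tensM -scalerAr.
Qed.

(** Let [m] be the largest power of [x] in [v], and
    [g0 x^m] a term with nonzero coefficient.  In [Delta v] the coordinate of
    [g0 x^m] in the left factor comes from this term only, through the extreme
    summand [g0 x^m (x) g0 a^m] of its coproduct; so slicing leaves a nonzero
    multiple of [g0 a^m]. *)
Lemma subcoalgebra_has_grouplike D :
  subcoalgebra Delta D -> D <> 0%VS -> exists h, gr h \in D.
Proof.
move=> DD D0.
have [v vD v0] : exists2 v, v \in D & v != 0.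
  have := vpick0 D; have /eqP/negbTE-> := D0 => /negbT v0.
  by exists (vpick D); rewrite ?memv_pick.
(* P m: some term g x^m occurs in v *)
pose P m := (m < n)%N && [exists g, coef g m v != 0].
have exP : exists m, P m.
  have [/existsP[m Pm]|] := boolP [exists m : 'I_n, P m]; first by exists m.
  move=> nP; case/negP: v0; rewrite [v]cE big1 // => g _; rewrite big1 // => m _.
  have /negP nPm : ~~ P m by apply: contraNN nP => Pm; apply/existsP; exists m.
  suff /eqP : coef g m v == 0 by rewrite /coef => ->; rewrite scale0r.
  by apply: contraT => cv; case: nPm; rewrite /P ltn_ord; apply/existsP; exists g.
have leP m : P m -> (m <= n)%N by case/andP => /ltnW.
case: (ex_maxnP exP leP) => m /andP[mn /existsP[g0 cv0]] m_max.
exists (g0 * a ^+ m)%g.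
have := slice_mem (coef g0 m) (subvP DD _ (memv_img Delta vD)).
suff -> : slice (coef g0 m) (Delta v) = coef g0 m v *: gr (g0 * a ^+ m)%g.
  move=> zD; rewrite -[gr _]scale1r -(mulVf cv0 : _ = 1 :> k) -scalerA.
  exact: memvZ.
have sl g i : (i < n)%N -> slice (coef g0 m) (Delta (gr g * x ^+ i)) =
  if (g0 == g) && (m <= i)%N then
    gauss_bin q^-1 i m *: (gr g * (gr a ^+ m * x ^+ (i - m))) else 0.
  move=> iN; rewrite HR_Delta_expand // linear_sum.
  have slj (j : 'I_i.+1) : slice (coef g0 m) (tens (gr g * x ^+ j)
      (gauss_bin q^-1 i j *: (gr g * (gr a ^+ j * x ^+ (i - j))))) =
     if (g0 == g) && (m == j) then
       gauss_bin q^-1 i j *: (gr g * (gr a ^+ j * x ^+ (i - j))) else 0.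
    rewrite slice_tens /= /coef cb; last by rewrite (leq_ltn_trans _ iN) // -ltnS.
    by case: ifP => _; rewrite ?scale1r ?scale0r.
  rewrite (eq_bigr _ (fun j _ => slj j)).
  case: ifP => [/andP[g0g mi]|gm].
    rewrite (bigD1 (Ordinal (mi : (m < i.+1)%N))) // g0g eqxx /=.
    rewrite big1 ?addr0 // => j jm; rewrite ifF // eq_sym.
    exact: negbTE jm.
  rewrite big1 // => j _; rewrite ifF //; apply: contraFF gm.
  by case/andP => -> /eqP->; rewrite -ltnS ltn_ord.
have -> : slice (coef g0 m) (Delta v) = \sum_g \sum_(i < n) coef g i v *:
    (if (g0 == g) && (m <= i)%N then
       gauss_bin q^-1 i m *: (gr g * (gr a ^+ m * x ^+ (i - m))) else 0).
  rewrite {1}[v]cE !linear_sum; apply: eq_bigr => g _.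
  rewrite !linear_sum; apply: eq_bigr => i _.
  by rewrite !linearZ; congr (_ *: _); apply: sl.
rewrite (bigD1 g0) //= [X in _ + X]big1 ?addr0; last first.
  move=> g gg0; rewrite big1 // => i _.
  by rewrite eq_sym (negbTE gg0) scaler0.
rewrite (bigD1 (Ordinal mn)) //= [X in _ + X]big1 ?addr0.
  rewrite eqxx leqnn gauss_bin_diag subnn mulr1 scale1r.
  by rewrite (HR_grM HR) HR_grX.
move=> i im; rewrite eqxx /=; case: ifP => [mi|_]; last exact: scaler0.
suff /eqP -> : coef g0 i v == 0 by rewrite scale0r.
apply: contraT => civ; have /m_max im' : P i.
  by rewrite /P ltn_ord; apply/existsP; exists g0.
by case/eqP: im; apply/val_inj/anti_leq; rewrite im' mi.
Qed.

Lemma simple_grouplike h : simple_subcoalgebra Delta <[gr h]>%VS.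
Proof.
have n0 : (0 < n)%N := ltnW degree_gt1.
have gr0 : gr h != 0.
  have := cb h 0 h n0; rewrite mulr1 !eqxx; apply: contra_eq_neq => ->.
  rewrite -[c _ _ _]/(coef h 0 0) linear0 eq_sym; exact: oner_neq0.
split.
- rewrite /subcoalgebra limg_line -memvE.
  have := HR_Delta HR h n0; rewrite expr0 !mulr1 => ->.
  by rewrite memv_tens ?memv_line.
- by move/eqP; rewrite -subv0 -memvE memv0 (negbTE gr0).
move=> E _ EL; have [->|E0] := eqVneq E 0%VS; first by left.
right; apply/eqP; rewrite eqEdim EL dim_vline gr0 lt0n dimv_eq0 E0 //.
Qed.

(** By [subcoalgebra_has_grouplike] the simple subcoalgebras are
    exactly the lines spanned by the grouplike elements of [G]. *)
Lemma coradical_kG H0 : is_coradical Delta H0 -> H0 = kG.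
Proof.
case=> H0_sub H0_min; apply/eqP; rewrite eqEsubv; apply/andP; split.
  apply: H0_min => D [DD D0 Dmin].
  have [h hD] := subcoalgebra_has_grouplike DD D0.
  have [sub_h h0 _] := simple_grouplike h.
  by case: (Dmin _ sub_h hD) => // <-; rewrite -memvE mem_gr.
apply/span_subvP => _ /codomP[g ->]; rewrite memvE; apply: H0_sub.
exact: simple_grouplike.
Qed.

(** The coefficient of [x^m] after applying the counit of [kG] to the
    coefficients: one coordinate of the quotient map from [H] to
    [k (x)_{kG} H]. *)
Definition level_sum (m : nat) (v : H) : k := \sum_g c g m v.

Lemma level_sum_lin m : scalar (level_sum m).
Proof.
move=> z u v; rewrite /level_sum mulr_sumr -big_split.
by apply: eq_bigr => g _; apply: c_lin.
Qed.

Lemma level_sum_basis m g i : (i < n)%N ->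
  level_sum m (gr g * x ^+ i) = (m == i)%:R.
Proof.
move=> iN; rewrite /level_sum (bigD1 g) //= cb // eqxx big1 ?addr0 // => h hg.
by rewrite cb // (negbTE hg).
Qed.

Lemma gr_mul_expand g v :
  gr g * v = \sum_h \sum_(i < n) c h i v *: (gr (g * h)%g * x ^+ i).
Proof.
rewrite {1}[v]cE mulr_sumr; apply: eq_bigr => h _; rewrite mulr_sumr.
by apply: eq_bigr => i _; rewrite -scalerAr (HR_grM HR) mulrA.
Qed.

Definition level_vec (m1 m2 m3 : nat) (v : H) : 'rV[k]_3 :=
  \row_l level_sum (nth 0 [:: m1; m2; m3] l)%N v.

Fact level_vec_is_linear m1 m2 m3 : linear (level_vec m1 m2 m3).
Proof. by move=> z u v; apply/rowP => l; rewrite !mxE level_sum_lin. Qed.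
HB.instance Definition _ m1 m2 m3 :=
  GRing.isLinear.Build k H 'rV[k]_3 _ (level_vec m1 m2 m3)
    (level_vec_is_linear m1 m2 m3).

Lemma level_vec_gr m1 m2 m3 g v :
  level_vec m1 m2 m3 (gr g * v) = level_vec m1 m2 m3 v.
Proof.
rewrite gr_mul_expand {2}[v]cE !linear_sum; apply: eq_bigr => h _.
rewrite !linear_sum; apply: eq_bigr => i _; rewrite !linearZ; congr (_ *: _).
by apply/rowP => l; rewrite !mxE !level_sum_basis.
Qed.

Lemma Delta_gr_mul g v : Delta (gr g * v) = tens (gr g) (gr g) * Delta v.
Proof.
rewrite gr_mul_expand {2}[v]cE !linear_sum mulr_sumr; apply: eq_bigr => h _.
rewrite !linear_sum mulr_sumr; apply: eq_bigr => i _.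
rewrite !linearZ [RHS](tensor_mulZr _ (tens (gr g) (gr g))); congr (_ *: _).
by rewrite /= !(HR_Delta HR) // (HR_grM HR) -tensM; apply/esym/tensor_mulA.
Qed.

Local Notation H1 := (coradical1 Delta kG).

Lemma mem_coradical1 v :
  (v \in H1) = (Delta v \in tensv fullv kG + tensv kG fullv)%VS.
Proof. by rewrite -memv_preim. Qed.

Lemma kG1 : 1 \in kG.
Proof. by rewrite -(HR_gr1 HR) mem_gr. Qed.

Lemma coradical1_gr g v : v \in H1 -> gr g * v \in H1.
Proof.
rewrite !mem_coradical1 Delta_gr_mul => /memv_addP[s sP [t tP ->]].
have gG u : u \in kG -> gr g * u \in kG.
  move: u; apply: kG_ind => [u w uG wG|z h]; first by rewrite mulrDr memvD.
  by rewrite -scalerAr -(HR_grM HR) memvZ // mem_gr.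
by rewrite mulrDr memv_add // tens_mul_tensv // => u _; rewrite memvf.
Qed.

Lemma skew_primitive_coradical1 v h :
  Delta v = tens v (gr h) + tens 1 v -> v \in H1.
Proof.
by move=> vE; rewrite mem_coradical1 vE memv_add // memv_tens ?memvf ?mem_gr ?kG1.
Qed.

Lemma Delta_x : Delta x = tens x (gr a) + tens 1 x.
Proof.
have := HR_Delta HR 1%g degree_gt1.
by rewrite (HR_gr1 HR) tens1 !expr1 !mul1r.
Qed.

(** All the middle terms of the quantum binomial formula vanish, [q]
    being a primitive [N]-th root of unity. *)
Lemma Delta_xN : (N < n)%N ->
  Delta (x ^+ N) = tens (x ^+ N) (gr (a ^+ N)%g) + tens 1 (x ^+ N).
Proof.
move=> Nn; rewrite -[x ^+ N]mul1r -(HR_gr1 HR) HR_Delta_expand // (HR_gr1 HR).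
have qN := prim_root_inv (adm_order adm).
have N_gt0 := ltnW order_gt1.
rewrite big_ord_recr /= gauss_bin_diag subnn mulr1 !mul1r scale1r -HR_grX addrC.
congr (_ + _); case: N qN N_gt0 => // m qN _.
rewrite big_ord_recl [X in _ + X]big1 => [|j _].
  by rewrite /= subn0 !expr0 !mul1r scale1r addr0.
by rewrite lift0 gauss_bin_root ?scale0r ?tens0r //= ltnS.
Qed.

(** If [r > 0] then [x^N] is a basis element of [H] different from
    [1] and [x].  The three of them lie in [H_1], and their images in
    [k (x)_{kG} H] are independent, so that [k (x)_{kG} H_1] has dimension at
    least 3. *)
Lemma rank_one_hgt0 : rank_one eps Delta kG -> hgt R = 0%N.
Proof.
rewrite /rank_one => dimH1; apply/eqP; apply: contraT; rewrite -lt0n => h_gt0.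
have p_gt1 : (1 < p)%N by rewrite prime_gt1 // (pcharf_prime pP).
have N_gt1 := order_gt1; have N_gt0 := ltnW N_gt1.
have Nn : (N < n)%N.
  by rewrite -{1}[N]mul1n ltn_pmul2r // -(expn0 p) ltn_exp2l.
have n_gt0 := ltn_trans N_gt0 Nn.
pose pi := linfun (level_vec 0 1 N).
have piE v : pi v = level_vec 0 1 N v by rewrite lfunE.
have pi_xX i : (i < n)%N ->
    pi (x ^+ i) = \row_l (nth 0 [:: 0; 1; N] l == i)%N%:R.
  move=> iN; rewrite piE; apply/rowP => l; rewrite !mxE -[x ^+ i]mul1r.
  by rewrite -(HR_gr1 HR) level_sum_basis.
have H1x m : m \in [:: 0; 1; N]%N -> x ^+ m \in H1.
  rewrite !inE => /or3P[] /eqP->.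
  - rewrite mem_coradical1 (subvP (addvSl _ _)) //.
    have := HR_Delta HR 1%g n_gt0; rewrite (HR_gr1 HR) !expr0 !mulr1 => ->.
    by rewrite memv_tens ?memvf ?kG1.
  - by apply: (@skew_primitive_coradical1 _ a); rewrite expr1 Delta_x.
  exact: skew_primitive_coradical1 (Delta_xN Nn).
have pi_full : (pi @: H1)%VS = fullv.
  apply/eqP; rewrite eqEsubv subvf; apply/subvP => w _.
  rewrite (row_sum_delta w) memv_suml // => l _; rewrite memvZ //.
  suff -> : delta_mx 0 l = pi (x ^+ (nth 0 [:: 0; 1; N] l)%N).
    by rewrite memv_img // H1x // mem_nth.
  rewrite pi_xX; last by have := degree_gt1; case: l => [[|[|[|]]]].
  apply/rowP => j; rewrite !mxE eqxx /= nth_uniq //.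
  by rewrite /= !inE; case: (N) N_gt1 => [|[]].
(* the level sums are invariant under kG, so they vanish on the balancing
   relations *)
have bal : (balancing eps kG H1 <= H1 :&: lker pi)%VS.
  apply/span_subvP => _ /allpairsP[[h m] /= [/vbasis_mem hG /vbasis_mem mH1 ->]].
  elim/kG_ind: h / hG => [s t sP tP|z g].
    by rewrite linearD /= scalerDl mulrDl opprD addrACA memvD.
  rewrite linearZ /= -scalerAl.
  have -> : eps (gr g) = 1 :> k.
    have := HR_eps HR g n_gt0; rewrite expr0 mulr1 => ->; exact: erefl.
  rewrite -[z *: 1]/(z * 1) mulr1 -scalerBr memvZ // memv_cap.
  rewrite rpredB ?coradical1_gr //=.
  by rewrite memv_ker linearB /= !piE level_vec_gr subrr.
have := limg_ker_dim pi H1; rewrite pi_full dimH1 dimvf.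
have := dimvS bal; rewrite /dim /=; lia.
Qed.

Lemma coef_prodv g i j : i != j -> (j < n)%N ->
  (kG * <[x ^+ j]> <= lker (linfun (coef g i)))%VS.
Proof.
move=> ij jn; apply/prodvP => s t sG /vlineP[z ->].
rewrite memv_ker lfunE /= -scalerAr linearZ /= coef_kG // (negbTE ij) mul0r.
by rewrite scaler0.
Qed.

(** The coordinate at [x^l] vanishes on the lower powers; in particular
    [x] has degree [n] over [kG]. *)
Lemma xX_notin l : (l < n)%N -> x ^+ l \notin (\sum_(i < l) kG * <[x ^+ i]>)%VS.
Proof.
move=> ln; apply/negP => xl.
have /subvP/(_ _ xl) :
    (\sum_(i < l) kG * <[x ^+ i]> <= lker (linfun (coef 1%g l)))%VS.
  apply/subv_sumP => i _; apply: coef_prodv; first by rewrite gtn_eqF.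
  exact: ltn_trans ln.
rewrite memv_ker lfunE /= -[x ^+ l]mul1r -(HR_gr1 HR) /coef cb // !eqxx.
by rewrite oner_eq0.
Qed.

Section HeightZero.
Hypothesis h0 : hgt R = 0%N.

Let nN : n = N. Proof. by rewrite h0 expn0 mul1n. Qed.

Lemma height0_expn : x ^+ N = alpha_m1 R *: (gr a ^+ N - 1).
Proof.
have := HR_expn HR; rewrite nN big1 ?addr0 // => i _.
by have := ltn_ord i; rewrite {2}h0.
Qed.

(** Otherwise [x^N = 0], and [x] is a nilpotent skew primitive
    eigenvector of degree [N]. *)
Lemma non_nilpotent_alpha : ~ nilpotent_type R gr Delta kG -> alpha_m1 R != 0.
Proof.
move=> nil; apply/eqP => alpha0; apply: nil.
have xN : x ^+ N = 0 by rewrite height0_expn alpha0 scale0r.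
exists x, N; split=> //; first exact: Delta_x.
- have := xX_notin degree_gt1; rewrite big_ord1 expr0 prodv1 expr1.
  by [].
- by exists q; apply: HR_conj HR a.
split; first by rewrite xN mem0v.
by move=> l lN; apply: xX_notin; rewrite nN.
Qed.

(** On [kG] this is the automorphism [g |-> chi(g)^-1 g]; it kills the
    terms of positive degree in [x]. *)
Definition twist (v : H) : H := \sum_g ((chi R g)^-1 * c g 0 v) *: gr g.

Fact twist_is_linear : linear twist.
Proof.
move=> z u v; rewrite /twist scaler_sumr -big_split; apply: eq_bigr => g _ /=.
by rewrite c_lin mulrDr scalerDl scalerA mulrCA.
Qed.
HB.instance Definition _ := GRing.isLinear.Build k H H _ twist twist_is_linear.

Lemma HR_skew_extension : alpha_m1 R != 0 ->
  skew_extension kG (linfun twist) x (gr a) N q (alpha_m1 R).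
Proof.
move=> alpha0; have n0 : (0 < n)%N := ltnW degree_gt1.
have twist_gr g : twist (gr g) = (chi R g)^-1 *: gr g.
  have ch h : c h 0%N (gr g) = (h == g)%:R.
    by rewrite -[gr g]mulr1 -(expr0 x) cb // andbT.
  rewrite /twist (bigD1 g) //= ch eqxx mulr1 big1 ?addr0 // => h hg.
  by rewrite ch (negbTE hg) mulr0 scale0r.
have chiN g : chi R g ^+ N = 1.
  by have := adm_alpha_m1_chi adm alpha0 g; rewrite h0 expn0 muln1.
have aC g : gr a * gr g = gr g * gr a.
  have /centerP[_ aZ] := adm_center adm.
  by rewrite -!(HR_grM HR) aZ ?inE.
split.
- exact: kG1.
- move=> s t sG tG; elim/kG_ind: s / sG => [s s' sP s'P|z g].
    by rewrite mulrDl memvD.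
  elim/kG_ind: t / tG => [s s' sP s'P|z' g']; first by rewrite mulrDr memvD.
  by rewrite -!(scalerAl, scalerAr) -(HR_grM HR) !memvZ ?mem_gr.
- by move=> s _; rewrite lfunE memv_suml // => g _; rewrite memvZ ?mem_gr.
- move=> s t sG tG; elim/kG_ind: s / sG => [s s' sP s'P|z g].
    by rewrite mulrDl !linearD /= mulrDl sP s'P.
  elim/kG_ind: t / tG => [s s' sP s'P|z' g'].
    by rewrite mulrDr !linearD /= mulrDr sP s'P.
  rewrite -!(scalerAl, scalerAr) !linearZ /= -!(scalerAl, scalerAr) -(HR_grM HR).
  rewrite !lfunE /= !twist_gr (adm_chiM adm) invfM (HR_grM HR).
  by congr (_ *: (_ *: _)); rewrite -scalerAl -scalerAr scalerA.
- have iterD m s t : iter m (linfun twist) (s + t)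
      = iter m (linfun twist) s + iter m (linfun twist) t.
    by elim: m => //= m ->; rewrite linearD.
  apply: kG_ind => [s t sP tP|z g]; first by rewrite iterD sP tP.
  have iterE m : iter m (linfun twist) (z *: gr g)
      = (chi R g)^-1 ^+ m *: (z *: gr g).
    elim: m => [|m IHm]; first by rewrite scale1r.
    rewrite /= IHm !linearZ /= lfunE /= twist_gr !scalerA.
    by congr (_ *: _); rewrite exprSr; ring.
  by rewrite iterE exprVn chiN invr1 scale1r.
- apply: kG_ind => [s t sP tP|z g]; first by rewrite mulrDr linearD /= mulrDl sP tP.
  by rewrite linearZ /= lfunE /= twist_gr -scalerAr HR_x -!scalerAl.
- exact: mem_gr.
- apply: kG_ind => [s t sP tP|z g]; first by rewrite mulrDr mulrDl sP tP.
  by rewrite -scalerAr aC scalerAl.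
- by exists (gr a^-1%g); rewrite -(HR_grM HR) mulVg (HR_gr1 HR).
- by rewrite lfunE /= twist_gr.
- exact: adm_order adm.
- exact: order_gt1.
- exact: height0_expn.
- move=> h; exists (fun i => \sum_g c g i h *: gr g).
    by move=> i; rewrite memv_suml // => g _; rewrite memvZ ?mem_gr.
  rewrite {1}[h]cE exchange_big /=.
  rewrite -(big_mkord xpredT (fun i => \sum_g c g i h *: (gr g * x ^+ i))) nN.
  rewrite big_mkord; apply: eq_bigr => i _; rewrite mulr_suml.
  by apply: eq_bigr => g _; rewrite scalerAl.
move=> s i sG iN sx0; rewrite (kG_coef sG) big1 // => g _.
have := coef_kG g i sG (_ : (i < n)%N); rewrite sx0 linear0 eqxx mul1r nN.
by move=> /(_ iN) <-; rewrite scale0r.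
Qed.

End HeightZero.

End Coordinates.

End RankOne.

(** * Blocks of the Hopf algebra *)

Theorem theorem3p18 (k : closedFieldType) (p : nat) (hp : p \in [pchar k])
    (gT : finGroupType) (R : datum k gT) (N : nat)
    (hR : admissible p N R)
    (H : falgType k) (gr : gT -> H) (x : H)
    (Delta : 'Hom(H, tensor H H)) (eps : 'Hom(H, k^o)) (S : 'End(H))
    (hH : is_HR p N R gr x Delta eps S)
    (H0 : {vspace H}) (hH0 : is_coradical Delta H0)
    (hrank : rank_one eps Delta H0)
    (hnil : ~ nilpotent_type R gr Delta H0)
    (hss : semisimple_subalgebra H0)
    (Taft : falgType k) (hTaft : is_taft N (chi R (pt R)) Taft)
    (B : {aspace H}) (hB : block B) :
  morita_equivalent (subvs_of B) Taft \/
  morita_equivalent (subvs_of B) 'M[k]_N.-1.+1.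
Proof.
have [c [c_lin cb cE]] := HR_coordinates hH.
have H0E := coradical_kG hp hR hH c_lin cb cE hH0; subst H0.
have h0 := rank_one_hgt0 hp hR hH c_lin cb cE hrank.
have alpha0 := non_nilpotent_alpha hp hR hH c_lin cb h0 hnil.
have ext := HR_skew_extension hp hR hH c_lin cb cE h0 alpha0.
have [f [y [b [sys corner]]]] := skew_extension_block ext hss hB.
case=> b_val; rewrite {}b_val in sys.
  by left; apply: corner_morita_taft sys corner hTaft.
by right; apply: corner_morita_matrix sys corner.
Qed.
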